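(* For every $(x,y,t),(x_0,y_0,t_0)\in\mathbb{R}^+\times\mathbb{R}^2$ with $t_0<t$ and $y_0>y$, set $$E=\frac{4}{(t-t_0)^2}\,g^{-1}\!\left(\frac{y_0-y}{(t-t_0)\sqrt{x\,x_0}}\right).$$ Then $$\Psi(x,y,t;x_0,y_0,t_0)=E(t-t_0)+\frac{4(x+x_0)}{y_0-y}-4\sqrt{E+\frac{4x\,x_0}{(y_0-y)^2}}\qquad\text{if } E\ge-\frac{\pi^2}{(t-t_0)^2},$$ $$\Psi(x,y,t;x_0,y_0,t_0)=E(t-t_0)+\frac{4(x+x_0)}{y_0-y}+4\sqrt{E+\frac{4x\,x_0}{(y_0-y)^2}}\qquad\text{if } -\frac{4\pi^2}{(t-t_0)^2}<E<-\frac{\pi^2}{(t-t_0)^2}.$$ Moreover, $$\frac{\Psi(x,y,t;x_0,y_0,t_0)}{\frac{4}{t-t_0}\log^2\!\Big(\frac{y_0-y}{(t-t_0)\sqrt{x x_0}}\Big)+\frac{4(x_0+x)}{y_0-y}}\to1\quad\text{as}\quad\frac{y_0-y}{(t-t_0)\sqrt{x_0x}}\to+\infty,$$ and $$\frac{\Psi(x,y,t;x_0,y_0,t_0)}{\frac{4(\sqrt{x}+\sqrt{x_0})^2}{y_0-y}-\frac{4\pi^2}{t-t_0}}\to1\quad\text{as}\quad\frac{y_0-y}{(t-t_0)\sqrt{x_0x}}\to0.$$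
   Context: $\mathbb{R}^+=\,]0,+\infty[$. The function $g:\,]-\pi^2,+\infty[\,\to\,]0,+\infty[$ is defined by $g(r)=\frac{\sinh\sqrt r}{\sqrt r}$ for $r>0$, $g(0)=1$, $g(r)=\frac{\sin\sqrt{-r}}{\sqrt{-r}}$ for $-\pi^2<r<0$; it is a strictly increasing bijection and $g^{-1}$ is its inverse. For $(x,y,t),(x_0,y_0,t_0)\in\mathbb{R}^+\times\mathbb{R}^2$ with $t>t_0$ and $y<y_0$, $\Psi(x,y,t;x_0,y_0,t_0)$ is the infimum of $\int_0^{t-t_0}\omega(s)^2\,ds$ over all $\omega\in L^1([0,t-t_0])$ for which the absolutely continuous solution of $\dot q_1(s)=\omega(s)q_1(s)$, $\dot q_2(s)=q_1(s)$, $q_1(0)=x$, $q_2(0)=y$, satisfies $q_1(t-t_0)=x_0$, $q_2(t-t_0)=y_0$. *)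

(* Defs.v *)
From HB Require Import structures.
From mathcomp Require Import all_boot all_order all_algebra.
From mathcomp Require Import all_classical all_reals all_analysis.

Set Implicit Arguments.
Unset Strict Implicit.
Unset Printing Implicit Defensive.

Import Order.TTheory GRing.Theory Num.Theory.
Import numFieldNormedType.Exports.

Local Open Scope classical_set_scope.
Local Open Scope ring_scope.

Definition sinh {R : realType} (s : R) : R := (expR s - expR (- s)) / 2.

(* Only the values on ]-pi^2, +oo[ matter; below it the formula is junk. *)
Definition g {R : realType} (r : R) : R :=
  if 0 < r then sinh (Num.sqrt r) / Num.sqrt r
  else if r == 0 then 1
  else sin (Num.sqrt (- r)) / Num.sqrt (- r).

(* [pinv A f z] is a preimage of [z] in [A]; it is unique here, as [g] is
   strictly increasing on ]-pi^2, +oo[. *)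
Definition ginv {R : realType} : R -> R := pinv `]- pi ^+ 2, +oo[ g.

(* The intervals may be degenerate, and may share endpoints. *)
Definition abs_continuous {R : realType} (a b : R) (f : R -> R) : Prop :=
  forall e : R, 0 < e -> exists2 d : R, 0 < d &
    forall (n : nat) (u v : 'I_n -> R),
      (forall i, a <= u i /\ u i <= v i /\ v i <= b) ->
      trivIset setT (fun i => [set` `]u i, v i[]) ->
      \sum_(i < n) (v i - u i) < d ->
      \sum_(i < n) `|f (v i) - f (u i)| < e.

(* Trajectories are functions on R of which only the restriction to [0, T] is
   constrained; the derivatives are taken in the interior of that interval. *)
Definition solution {R : realType} (T : R) (w q1 q2 : R -> R) : Prop :=
  [/\ abs_continuous 0 T q1, abs_continuous 0 T q2,
      {ae lebesgue_measure, forall s : R, s \in `]0, T[ ->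
         is_derive s (1 : R) q1 (w s * q1 s)} &
      {ae lebesgue_measure, forall s : R, s \in `]0, T[ ->
         is_derive s (1 : R) q2 (q1 s)}].

Definition admissible {R : realType} (x y t x0 y0 t0 : R) : set (R -> R) :=
  [set w | lebesgue_measure.-integrable `[0, t - t0] (EFin \o w) /\
     exists q1 q2 : R -> R,
       [/\ solution (t - t0) w q1 q2, q1 0 = x, q2 0 = y,
           q1 (t - t0) = x0 & q2 (t - t0) = y0]].

(* The cost of an integrable control that is not square integrable is +oo. *)
Definition Psi {R : realType} (x y t x0 y0 t0 : R) : \bar R :=
  ereal_inf
    [set (\int[lebesgue_measure]_(s in `[0%R, (t - t0)%R]) ((w s) ^+ 2)%:E)%E
    | w in admissible x y t x0 y0 t0].

Definition normalized_gap {R : realType} (x y t x0 y0 t0 : R) : R :=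
  (y0 - y) / ((t - t0) * Num.sqrt (x * x0)).

Definition energy {R : realType} (x y t x0 y0 t0 : R) : R :=
  4 / (t - t0) ^+ 2 * ginv (normalized_gap x y t x0 y0 t0).

(* Main.v *)
Require Import Defs.
From HB Require Import structures.
From mathcomp Require Import all_boot all_order all_algebra.
From mathcomp Require Import all_classical all_reals all_analysis.
From mathcomp Require Import measurable_realfun lra.

Set Implicit Arguments.
Unset Strict Implicit.
Unset Printing Implicit Defensive.

Import Order.TTheory GRing.Theory Num.Theory.
Import numFieldNormedType.Exports.

Local Open Scope classical_set_scope.
Local Open Scope ring_scope.

(* Put u = ln q1, T = t - t0 and h = y0 - y: one minimizes the integral of u'^2
   over [0, T] with prescribed end values and integral of e^u equal to h. The
   extremals satisfy u'^2 - lam e^u = E for a multiplier lam, so that the cost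
   is E T + lam h; moreover p = e^(-u/2) solves the linear equation
   p'' = (E/4) p, whence 1/p^2 integrates to h exactly when
   h = T g(E T^2/4) sqrt(x x0).
   Minimality holds because the problem is convex in one of two coordinate
   systems: for E <= 0 one has lam >= 0 and u'^2 + lam e^u is convex in (u, u');
   for E > 0, taking q2 as the time tau and z = sqrt q1 as the unknown, the cost
   is the integral of 4 (dz/dtau)^2 under the constraint that 1/z^2 integrates
   to T, and 4 z'^2 + E/z^2 is convex in (z, z'). Each time the convexity
   inequality says that w^2 dominates the derivative of an explicit function
   along the trajectory.
   The asymptotics are then those of the solution r of g(r) = rho. *)

(** The trajectories are differentiable only almost everywhere, so a pointwise bound of a derivative
    by w^2 becomes a bound on the cost only through absolute continuity; and since the explicit
    functions contain ln q1, positivity of [q1] has to be established beforehand. The increments of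
    these functions over [0, T] depend only on the end data, and the pointwise bound is an equality
    along the extremal, which is why the bound coincides with the cost of the extremal. With r = E
    T^2/4, the two closed formulas are one expression, 4 r/T + (4 (x + x0) - 8 sqrt(x x0) cosg r)/h,
    where [cosg] plays the part of cosh for [g]. The identity cosg^2 = 1 + r g^2 turns the square
    root of the statement into 2 sqrt(x x0) |cosg r|/h, and the sign in front of it changes where
    that of [cosg] does, at r = - pi^2/4, that is at E = - pi^2/T^2. *)

(** * Differentiation rules on the real line *)

Section RealDerivatives.
Variable R : realType.
Implicit Types (f g : R -> R) (x a b c : R).

Lemma is_derive1D f g x a b : is_derive x (1 : R) f a -> is_derive x (1 : R) g b ->
  is_derive x (1 : R) (fun s => f s + g s) (a + b).
Proof. by move=> df dg; exact: (@is_deriveD R R R f g x 1 a b df dg). Qed.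

Lemma is_derive1B f g x a b : is_derive x (1 : R) f a -> is_derive x (1 : R) g b ->
  is_derive x (1 : R) (fun s => f s - g s) (a - b).
Proof. by move=> df dg; exact: (@is_deriveB R R R f g x 1 a b df dg). Qed.

Lemma is_derive1M f g x a b : is_derive x (1 : R) f a -> is_derive x (1 : R) g b ->
  is_derive x (1 : R) (fun s => f s * g s) (a * g x + f x * b).
Proof.
move=> df dg; apply: is_derive_eq (@is_deriveM R R f g x 1 a b df dg) _.
by rewrite addrC /GRing.scale/= (mulrC (g x)).
Qed.

Lemma is_derive1_cst c x : is_derive x (1 : R) (fun _ => c) 0.
Proof. exact: (@is_derive_cst R R R c x 1). Qed.

Lemma is_derive1_id x : is_derive x (1 : R) (fun s : R => s) 1.
Proof. exact: (@is_derive_id R R x 1). Qed.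

Lemma is_derive1Z c f x a : is_derive x (1 : R) f a ->
  is_derive x (1 : R) (fun s => c * f s) (c * a).
Proof. by move=> df; exact: (@is_deriveZ R R R f c x 1 a df). Qed.

Lemma is_derive1V f x a : f x != 0 -> is_derive x (1 : R) f a ->
  is_derive x (1 : R) (fun s => (f s)^-1) (- a / f x ^+ 2).
Proof.
move=> fx df; apply: is_derive_eq (is_deriveV fx df) _.
by rewrite /GRing.scale/= mulNr mulrC mulNr -exprVn.
Qed.

Lemma is_derive1_chain f g x a b : is_derive (g x) (1 : R) f a ->
  is_derive x (1 : R) g b -> is_derive x (1 : R) (fun s => f (g s)) (a * b).
Proof. by move=> df dg; exact: (@is_derive1_comp R f g x a b df dg). Qed.

Lemma is_derive1_derivable f x a : is_derive x (1 : R) f a -> derivable f x 1.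
Proof. by move=> df; exact: (@ex_derive R R R x 1 f a df). Qed.

End RealDerivatives.

(** * Increment bounds from derivatives known almost everywhere *)

(** Split the interval at [x] and add the two one-sided estimates; the ends [u] and [v] may then
    approach [x] independently, as real induction requires. *)
Lemma is_derive_straddle (R : realType) (f : R -> R) (x l e : R) :
  is_derive x (1 : R) f l -> 0 < e ->
  exists2 d : R, 0 < d & forall u v : R,
    x - d < u -> u <= x -> x <= v -> v < x + d ->
    f v - f u <= (l + e) * (v - u).
Proof.
move=> [df fl] e0.
have cf : h^-1 *: (f (h *: (1 : R) + x) - f x) @[h --> (0 : R)^'] --> l.
  by rewrite -fl; exact: df.
have [d /= d0 dP] : \forall h \near (0 : R)^',
    `|l - h^-1 *: (f (h *: (1 : R) + x) - f x)| < e.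
  by move/cvgrPdist_lt : cf => /(_ _ e0).
have incr h : `|h| < d -> `|f (h + x) - f x - l * h| <= e * `|h|.
  move=> hd; have [->|h0] := eqVneq h 0.
    by rewrite add0r subrr mulr0 subr0 normr0 mulr0.
  have := dP h; rewrite /ball/= sub0r normrN => /(_ hd h0)/ltW.
  rewrite distrC -(ler_pM2r (x := `|h|)) ?normr_gt0// -normrM mulrBl.
  by rewrite /GRing.scale/= mulr1 mulrAC mulVf// mul1r.
exists d => // u v du ux xv vd.
have := incr (u - x); have := incr (v - x).
rewrite !subrK.
have vd' : `|v - x| < d by rewrite ltr_norml; lra.
have ud' : `|u - x| < d by rewrite ltr_norml; lra.
move=> /(_ vd'); rewrite ler_norml => /andP[_].
rewrite (ger0_norm (x := v - x)) ?subr_ge0// => A.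
move=> /(_ ud'); rewrite ler_norml => /andP[+ _].
rewrite (ler0_norm (x := u - x)) ?subr_le0// => B.
lra.
Qed.

(* Real induction on an open neighbourhood [U] of the exceptional set: every
   point has a neighbourhood whose straddling intervals either lie in [U], or
   satisfy the increment bound. *)
Lemma covering_increment (R : realType) (a b eta : R) (F K : R -> R)
    (U : set R) :
  a <= b -> 0 <= eta ->
  {in `[a, b] &, {homo K : s t / s <= t}} ->
  (forall x, a <= x <= b -> exists2 d, 0 < d &
     forall u v, a <= u -> v <= b -> x - d < u -> u <= x -> x <= v ->
       v < x + d ->
       `[u, v] `<=` U \/ (F v - K v) - (F u - K u) <= eta * (v - u)) ->
  exists n (u v : 'I_n -> R),
    [/\ forall i, [/\ a <= u i, u i <= v i & v i <= b],
        trivIset setT (fun i => [set` `]u i, v i[]),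
        forall i, `[u i, v i] `<=` U &
        (F b - K b) - (F a - K a) <=
          eta * (b - a) + \sum_(i < n) (F (v i) - F (u i))].
Proof.
move=> ab eta0 Kmono good.
pose P s := exists n (u v : 'I_n -> R),
    [/\ forall i, [/\ a <= u i, u i <= v i & v i <= s],
        trivIset setT (fun i => [set` `]u i, v i[]),
        forall i, `[u i, v i] `<=` U &
        (F s - K s) - (F a - K a) <=
          eta * (s - a) + \sum_(i < n) (F (v i) - F (u i))].
pose S := [set s | a <= s <= b /\ P s].
have Sa : S a.
  split; first by rewrite lexx.
  exists 0%N, (fun=> a), (fun=> a); split; [by case|by case|by case|].
  by rewrite big_ord0; lra.
have hS : has_sup S.
  by split; [exists a | exists b => s [/andP[]]].
have step s t : a <= s -> s <= t -> t <= b -> P s ->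
    (`[s, t] `<=` U \/ (F t - K t) - (F s - K s) <= eta * (t - s)) -> P t.
  move=> a_s st tb [n [u [v [uv tuv uvU FK]]]] [stU|FKst]; last first.
    exists n, u, v; split => //.
      by move=> i; have [? ? ?] := uv i; split => //; lra.
    lra.
  pose u' (i : 'I_n.+1) := if unlift ord0 i is Some j then u j else s.
  pose v' (i : 'I_n.+1) := if unlift ord0 i is Some j then v j else t.
  exists n.+1, u', v'; split.
  - move=> i; rewrite /u' /v'; case: unliftP => [j _|_] //.
    by have [? ? ?] := uv j; split => //; lra.
  - apply/trivIsetP => i j _ _; rewrite /u' /v'.
    case: (unliftP ord0 i) => [i' ->|->]; case: (unliftP ord0 j) => [j' ->|->].
    + move=> ij; move/trivIsetP : tuv => /(_ i' j' I I); apply.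
      by apply: contra ij => /eqP ->.
    + move=> _; rewrite -subset0 => z []; rewrite /= !in_itv/=.
      by have [? ? ?] := uv i' => /andP[? ?] /andP[? ?]; lra.
    + move=> _; rewrite -subset0 => z []; rewrite /= !in_itv/=.
      by have [? ? ?] := uv j' => /andP[? ?] /andP[? ?]; lra.
    + by rewrite eqxx.
  - by move=> i; rewrite /u' /v'; case: unliftP.
  - rewrite big_ord_recl /u' /v' unlift_none.
    under eq_bigr do rewrite liftK.
    (* On an interval inside [U] the term in [K] has the right sign and is dropped: [F - K] grows by
       at most [F t - F s]. *)
    have : K s <= K t by apply: Kmono => //; rewrite in_itv/=; lra.
    have : 0 <= eta * (t - s) by rewrite mulr_ge0// subr_ge0.
    move: FK; set sg := \sum_(i < n) _; lra.
pose m := sup S.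
have am : a <= m by exact: (ub_le_sup hS.2 Sa).
have mb : m <= b by apply: ge_sup; [exists a|move=> s [/andP[]]].
have amb : a <= m <= b by rewrite am.
have [d d0 dP] := good m amb.
have [s [/andP[a_s sb] Ps] ms] := sup_adherent d0 hS.
have sm : s <= m by apply: (ub_le_sup hS.2); split => //; rewrite a_s.
(* The interval from [s], just below the supremum [m], to [t] straddles [m], so one more [step]
   reaches [t]; maximality gives [t <= m], which is possible only if [m = b]. *)
pose t := Num.min (m + d / 2) b.
have tb : t <= b by rewrite /t ge_min lexx orbT.
have mt : m <= t by rewrite /t le_min mb andbT; lra.
have td : t < m + d by rewrite /t gt_min; apply/orP; left; lra.
have Pt : P t by apply: (step s) => //; [lra | exact: dP].
have tm : t <= m by apply: (ub_le_sup hS.2); split => //; apply/andP; split => //; lra.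
have -> : b = t; last exact: Pt.
move: tm; rewrite {1}/t ge_min => /orP[|]; first by lra.
by move=> bm; apply/eqP; rewrite eq_le tb (le_trans bm mt).
Qed.

Lemma sum_length_le_measure (R : realType) (U : set R) (d : R) n
    (u v : 'I_n -> R) :
  open U -> (@lebesgue_measure R U < d%:E)%E ->
  (forall i, u i <= v i) -> (forall i, `[u i, v i] `<=` U) ->
  trivIset setT (fun i => [set` `]u i, v i[]) ->
  \sum_(i < n) (v i - u i) < d.
Proof.
move=> oU Ud uv uvU tuv; rewrite -lte_fin; apply: le_lt_trans Ud.
have -> : (\sum_(i < n) (v i - u i))%:E =
    (\sum_(i < n) @lebesgue_measure R [set` `]u i, v i[])%E.
  rewrite -sumEFin; apply: eq_bigr => i _; rewrite lebesgue_measure_itv/= lte_fin.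
  by case: ltgtP (uv i) => // ->; rewrite subrr.
rewrite -(@measure_bigsetU_ord _ _ _ lebesgue_measure n xpredT
  (fun i => [set` `]u i, v i[]))//=.
apply: le_measure; rewrite ?inE.
- by apply: bigsetU_measurable => i _; exact: measurable_itv.
- exact: open_measurable.
- apply: (big_ind (fun V => V `<=` U)); [by []|by move=> V W VU WU z []; [exact: VU|exact: WU]|].
  by move=> i _ z zi; apply: (uvU i); exact: subset_itv_oo_cc.
Qed.

(* Comparing with the nondecreasing primitive of [k], rather than with an
   absolutely continuous one, makes the absolute continuity of the Lebesgue
   integral unnecessary. *)
Lemma abs_continuous_increment_le (R : realType) (a b : R) (F k : R -> R) :
  a <= b -> abs_continuous a b F -> (forall s, 0 <= k s) ->
  (@lebesgue_measure R).-integrable `[a, b] (EFin \o k) ->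
  {ae @lebesgue_measure R, forall s, s \in `]a, b[ ->
     exists2 l, is_derive s (1 : R) F l & l <= k s} ->
  F b - F a <= \int[lebesgue_measure]_(s in `[a, b]) k s.
Proof.
move=> ab acF k0 intk aeF.
pose k1 := k \_ `[a, b].
have k10 s : 0 <= k1 s by rewrite /k1 patchE; case: ifP.
have intk1 : (@lebesgue_measure R).-integrable setT (EFin \o k1).
  have mab : measurable (`[a, b] : set (measurableTypeR R)) by [].
  rewrite /k1 -restrict_EFin.
  exact: (@integrable_mkcond _ _ _ lebesgue_measure _ (EFin \o k) mab).1.
have intk1' (y : R) : (@lebesgue_measure R).-integrable `[a, y] (EFin \o k1).
  by apply: integrableS intk1.
pose K s := \int[lebesgue_measure]_(t in `[a, s]) k1 t.
have Ka : K a = 0 by rewrite /K set_itv1 Rintegral_set1.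
have Kb : K b = \int[lebesgue_measure]_(s in `[a, b]) k s.
  by apply: eq_Rintegral => s sab; rewrite /k1 patchE sab.
have Kmono : {in `[a, b] &, {homo K : s t / s <= t}}.
  move=> s t /[!in_itv]/= /andP[a_s sb] /andP[at_ tb] st.
  rewrite -subr_ge0 /K Rintegral_itvB ?bnd_simp//.
  by apply: Rintegral_ge0.
have aeK := FTC1 intk1' (integrable_locally_restrict (measurable_itv _) intk).
(* Outside this null set [F - K] has a nonpositive derivative. The set is covered by an open [U] so
   small that absolute continuity keeps the increments of [F] over disjoint intervals inside [U]
   below [e / 2] in total. *)
pose N := (~` [set s | s \in `]a, b[ ->
     exists2 l, is_derive s (1 : R) F l & l <= k s]) `|`
  (~` [set s | (a%:E < s%:E)%E -> derivable K s 1 /\ K^`()%classic s = k1 s])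
  `|` ([set a] `|` [set b]).
have [A [mA A0 NA]] : (@lebesgue_measure R).-negligible N.
  apply: negligibleU; first by apply: negligibleU.
  by apply: negligibleU; apply/negligibleP => //; exact: lebesgue_measure_set1.
rewrite -Kb; apply/ler_addgt0Pr => e e0.
have e20 : 0 < e / 2 by rewrite divr_gt0.
have [d d0 dP] := acF _ e20.
have [U [oU AU Ud]] : exists U : set R, [/\ open U , A `<=` U &
    (@lebesgue_measure R (U `\` A) < d%:E)%E].
  by apply: lebesgue_regularity_outer => //; rewrite -[ltLHS]/(lebesgue_measure A) [ltLHS]A0.
have mU : measurable U by exact: open_measurable.
have {}Ud : (@lebesgue_measure R U < d%:E)%E.
  apply: le_lt_trans Ud.
  rewrite -[leLHS](_ : @lebesgue_measure R ((U `\` A) `|` A) = _); last first.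
    by rewrite setUC setDUK.
  apply: (le_trans (measureU2 _ _ _)) => //; first exact: measurableD.
  by rewrite -[leRHS]adde0 leeD// [leLHS]A0.
(* The [+ 1] keeps the denominator positive when [a = b]. *)
pose eta := e / 2 / (b - a + 1).
have ba1 : 0 < b - a + 1 by lra.
have eta0 : 0 < eta by rewrite divr_gt0.
have etab : eta * (b - a) <= e / 2.
  have : eta * (b - a + 1) = e / 2 by rewrite /eta divfK// gt_eqF.
  lra.
have [|n [u [v [uv tuv uvU FK]]]] :=
    @covering_increment R a b eta F K U ab (ltW eta0) Kmono.
  move=> x axb; have [xU|xU] := pselect (U x).
    have /nbhs_ballP[r /= r0 rU] : nbhs x U by exact: open_nbhs_nbhs.
    exists r => // s t _ _ xs sx xt tx; left => z /=; rewrite in_itv/= => /andP[sz zt].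
    by apply: rU; rewrite /ball/= ltr_norml; lra.
  have /not_orP[/not_orP[xF xK] /not_orP[/= xa xb]] : ~ N x by move=> /NA/AU.
  have xab : x \in `]a, b[.
    move/eqP: xa; move/eqP: xb; rewrite in_itv/= !lt_neqAle (eq_sym a) => -> ->; move: axb.
    done.
  move/contrapT : xF => /(_ xab)[l dF lk].
  have ax : a < x by move: xab; rewrite in_itv => /andP[].
  move/contrapT : xK => /=; rewrite lte_fin => /(_ ax)[dK Kk].
  have dK1 : is_derive x (1 : R) K (k1 x).
    by split; [exact: dK|rewrite -derive1E; exact: Kk].
  have dFK := is_derive1B dF dK1.
  have [r r0 rP] := is_derive_straddle dFK eta0.
  exists r => // s t _ _ xs sx xt tx; right.
  have := rP s t xs sx xt tx => /= /le_trans; apply.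
  apply: ler_wpM2r; first by lra.
  by rewrite /k1 patchE mem_set; [lra|exact: subset_itv_oo_cc].
have := dP n u v (fun i => _) tuv (sum_length_le_measure oU Ud _ uvU tuv).
move=> /(_ _ _)sumF.
have : \sum_(i < n) (F (v i) - F (u i)) < e / 2.
  apply: (le_lt_trans (ler_norm _)); apply: (le_lt_trans (ler_norm_sum _ _ _)).
  by apply: sumF => i; have [? ? ?] := uv i.
move: FK; set sg := \sum_(i < n) _; rewrite Ka; lra.
Qed.

(** * Closure properties of absolutely continuous functions *)

Lemma continuous_bounded (R : realType) (a b : R) (f : R -> R) :
  a <= b -> {within `[a, b], continuous f} ->
  exists2 M, 0 <= M & forall s, a <= s -> s <= b -> `|f s| <= M.
Proof.
move=> ab cf.
have [c _ cP] := EVT_max ab cf; have [d _ dP] := EVT_min ab cf.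
exists (`|f c| + `|f d|); first by rewrite addr_ge0.
move=> s a_s sb; have sab : s \in `[a, b] by rewrite in_itv/= a_s.
have := cP _ sab; have := dP _ sab.
have := ler_norm (f c); have := ler_norm (- f d); rewrite normrN => ? ? ? ?.
by have := normr_ge0 (f c); have := normr_ge0 (f d); rewrite ler_norml; lra.
Qed.

Section AbsolutelyContinuous.
Variables (R : realType) (a b : R).
Implicit Types (f g phi dphi : R -> R).

Lemma abs_continuousS f (c d : R) :
  a <= c -> d <= b -> abs_continuous a b f -> abs_continuous c d f.
Proof.
move=> ac db acf e /acf[r r0 rP]; exists r => // n u v uv; apply: rP => i.
by have [? [? ?]] := uv i; split; [|split]; lra.
Qed.

Lemma abs_continuous_unif f : abs_continuous a b f ->
  forall e : R, 0 < e -> exists2 d : R, 0 < d &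
    forall s t : R, a <= s -> s <= t -> t <= b -> t - s < d ->
      `|f t - f s| < e.
Proof.
move=> acf e /acf[d d0 dP]; exists d => // s t a_s st tb std.
have := dP 1%N (fun=> s) (fun=> t); rewrite !big_ord1; apply => //.
by apply/trivIsetP => i j _ _; rewrite (ord1 i) (ord1 j) eqxx.
Qed.

Lemma abs_continuous_within f : abs_continuous a b f ->
  {within `[a, b], continuous f}.
Proof.
move=> acf; apply/subspace_continuousP => x /=; rewrite in_itv/= => /andP[ax xb].
apply/cvgrPdist_lt => e /(abs_continuous_unif acf)[d d0 dP].
exists d => //= y; rewrite /ball_/= ltr_norml => /andP[y1 y2].
rewrite in_itv/= => /andP[ay yb].
rewrite -[X in `|X|]/(f x - f y); have [xy|yx] := leP x y.
  by rewrite distrC; apply: dP => //; lra.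
by apply: dP => //; lra.
Qed.

Lemma abs_continuous_bounded f : a <= b -> abs_continuous a b f ->
  exists2 M, 0 <= M & forall s, a <= s -> s <= b -> `|f s| <= M.
Proof. by move=> ab /abs_continuous_within; exact: continuous_bounded. Qed.

(** Sums, differences, products and compositions all reduce to this domination of increments. The
    threshold uses [C + 1] so that [C = 0] is allowed. *)
Lemma abs_continuous_le f1 f2 f (C : R) :
  abs_continuous a b f1 -> abs_continuous a b f2 -> 0 <= C ->
  (forall s t, a <= s -> s <= t -> t <= b ->
     `|f t - f s| <= C * (`|f1 t - f1 s| + `|f2 t - f2 s|)) ->
  abs_continuous a b f.
Proof.
move=> ac1 ac2 C0 fle e e0.
have k0 : 0 < e / (2 * (C + 1)) by rewrite divr_gt0// mulr_gt0//; lra.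
have [d1 d10 d1P] := ac1 _ k0; have [d2 d20 d2P] := ac2 _ k0.
exists (Num.min d1 d2); first by rewrite lt_min d10.
move=> n u v uv tuv; rewrite lt_min => /andP[/(d1P n u v uv tuv) s1].
move=> /(d2P n u v uv tuv) s2.
have : \sum_(i < n) `|f (v i) - f (u i)| <=
    C * (\sum_(i < n) `|f1 (v i) - f1 (u i)| + \sum_(i < n) `|f2 (v i) - f2 (u i)|).
  rewrite -big_split/= mulr_sumr; apply: ler_sum => i _.
  by have [? [? ?]] := uv i; exact: fle.
move=> /le_lt_trans; apply; move: s1 s2.
set S1 := \sum_(i < n) _; set S2 := \sum_(i < n) _.
set k := e / _ in k0 *; move=> s1 s2.
have -> : e = (C + 1) * (k + k).
  have : k * (2 * (C + 1)) = e by rewrite divfK// gt_eqF//; lra.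
  lra.
apply: (@le_lt_trans _ _ (C * (k + k))); last by rewrite ltr_pM2r; lra.
by apply: ler_wpM2l => //; lra.
Qed.

Lemma abs_continuous_cst (c : R) : abs_continuous a b (fun _ => c).
Proof.
move=> e e0; exists 1 => // n u v _ _ _.
by rewrite big1// => i _; rewrite subrr normr0.
Qed.

Lemma abs_continuous_id : abs_continuous a b (fun s => s).
Proof.
move=> e e0; exists e => // n u v uv _ /le_lt_trans; apply.
by apply: ler_sum => i _; have [_ [? _]] := uv i; rewrite ger0_norm ?subr_ge0.
Qed.

Lemma abs_continuousD f g : abs_continuous a b f -> abs_continuous a b g ->
  abs_continuous a b (fun s => f s + g s).
Proof.
move=> acf acg; apply: (abs_continuous_le acf acg ler01) => s t _ _ _.
by rewrite mul1r opprD addrACA; exact: ler_normD.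
Qed.

Lemma abs_continuousB f g : abs_continuous a b f -> abs_continuous a b g ->
  abs_continuous a b (fun s => f s - g s).
Proof.
move=> acf acg; apply: (abs_continuous_le acf acg ler01) => s t _ _ _.
have -> : f t - g t - (f s - g s) = f t - f s - (g t - g s) by lra.
by rewrite mul1r; exact: ler_normB.
Qed.

Lemma abs_continuousM f g : a <= b ->
  abs_continuous a b f -> abs_continuous a b g ->
  abs_continuous a b (fun s => f s * g s).
Proof.
move=> ab acf acg.
have [M M0 fM] := abs_continuous_bounded ab acf.
have [N N0 gN] := abs_continuous_bounded ab acg.
apply: (abs_continuous_le acf acg (addr_ge0 M0 N0)) => s t a_s st tb.
have -> : f t * g t - f s * g s = (f t - f s) * g t + f s * (g t - g s) by lra.
apply: (le_trans (ler_normD _ _)); rewrite !normrM.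
have := gN t; have := fM s => /(_ _ _)fs /(_ _ _)gt.
have {}fs : `|f s| <= M by apply: fs => //; lra.
have {}gt : `|g t| <= N by apply: gt => //; lra.
rewrite mulrDr; apply: lerD.
  by rewrite mulrC ler_wpM2r//; lra.
by rewrite ler_wpM2r//; lra.
Qed.

(** By the mean value theorem [phi] is Lipschitz on the compact interval that contains the values of
    [f]. *)
Lemma abs_continuous_comp f phi dphi (c d : R) :
  c <= d -> (forall x, c <= x -> x <= d -> is_derive x (1 : R) phi (dphi x)) ->
  {within `[c, d], continuous dphi} ->
  (forall s, a <= s -> s <= b -> c <= f s /\ f s <= d) ->
  abs_continuous a b f -> abs_continuous a b (fun s => phi (f s)).
Proof.
move=> cd dphiP cdphi fcd acf.
have [M M0 dphiM] := continuous_bounded cd cdphi.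
have lip x y : c <= x -> x <= y -> y <= d ->
    `|phi y - phi x| <= M * (y - x).
  move=> cx xy yd; have [||z] := @MVT_segment R phi dphi x y xy.
  - by move=> z; rewrite in_itv/= => /andP[? ?]; apply: dphiP; lra.
  - apply: derivable_within_continuous => z; rewrite in_itv/= => /andP[? ?].
    by apply: (@ex_derive _ _ _ _ _ _ _ (dphiP z _ _)); lra.
  rewrite in_itv/= => /andP[? ?] ->.
  rewrite normrM (ger0_norm (x := y - x)) ?subr_ge0// ler_wpM2r ?subr_ge0//.
  by apply: dphiM; lra.
apply: (abs_continuous_le acf acf M0) => s t a_s st tb.
have [fs1 fs2] := fcd s a_s (le_trans st tb).
have [ft1 ft2] := fcd t (le_trans a_s st) tb.
have M'0 : 0 <= M * `|f t - f s| by rewrite mulr_ge0.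
rewrite mulrDr; have [sf|fs] := leP (f s) (f t).
  by have := lip _ _ fs1 sf ft2; rewrite (ger0_norm (x := f t - f s)) ?subr_ge0// in M'0 *; lra.
have := lip _ _ ft1 (ltW fs) fs2.
rewrite distrC (distrC (f t) (f s)) (ger0_norm (x := f s - f t)); last by lra.
by rewrite distrC ger0_norm in M'0; lra.
Qed.

End AbsolutelyContinuous.

(** A positive continuous function on a compact interval has a positive minimum, so [phi] may be
    singular at 0, as ln and the inverse are. *)
Lemma abs_continuous_comp_pos (R : realType) (a b : R) (q phi dphi : R -> R) :
  a <= b -> (forall x : R, 0 < x -> is_derive x (1 : R) phi (dphi x)) ->
  (forall x : R, 0 < x -> {for x, continuous dphi}) ->
  (forall s, a <= s -> s <= b -> 0 < q s) ->
  abs_continuous a b q -> abs_continuous a b (fun s => phi (q s)).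
Proof.
move=> ab dphiP cdphi q0 acq.
have [m mab mP] := EVT_min ab (abs_continuous_within acq).
have [M _ MP] := abs_continuous_bounded ab acq.
have qm0 : 0 < q m by move: mab; rewrite in_itv/= => /andP[]; exact: q0.
have qmM s : a <= s -> s <= b -> q m <= q s /\ q s <= M.
  move=> a_s sb; split; first by apply: mP; rewrite in_itv/= a_s.
  exact: le_trans (ler_norm _) (MP _ a_s sb).
apply: (@abs_continuous_comp R a b q phi dphi (q m) M) => //.
- by have [] := qmM a (lexx _) ab; exact: le_trans.
- by move=> x qx _; apply: dphiP; exact: lt_le_trans qx.
- apply: continuous_in_subspaceT => x; rewrite inE/= in_itv/= => /andP[qx _].
  by apply: cdphi; exact: lt_le_trans qx.
Qed.

Lemma abs_continuous_ln (R : realType) (a b : R) (q : R -> R) :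
  a <= b -> (forall s, a <= s -> s <= b -> 0 < q s) ->
  abs_continuous a b q -> abs_continuous a b (fun s => ln (q s)).
Proof.
move=> ab; apply: abs_continuous_comp_pos => // x x0.
by apply: inv_continuous; rewrite gt_eqF.
Qed.

Lemma abs_continuous_inv (R : realType) (a b : R) (q : R -> R) :
  a <= b -> (forall s, a <= s -> s <= b -> 0 < q s) ->
  abs_continuous a b q -> abs_continuous a b (fun s => (q s)^-1).
Proof.
move=> ab; apply: (@abs_continuous_comp_pos R a b q GRing.inv
    (fun x => - (1 * (x ^-1) ^+ 2))) => // x x0.
  apply: is_derive_eq (is_derive1V _ (is_derive1_id x)) _; first by rewrite gt_eqF.
  by rewrite exprVn mulNr.
have cV : {for x, continuous (@GRing.inv R)} by apply: inv_continuous; rewrite gt_eqF.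
by apply: continuousN; apply: continuousM; [exact: cst_continuous|exact: continuousM].
Qed.

(** * Trajectories: positivity, monotonicity and lower bounds on the cost *)

(* On an interval where [q1] is positive, [-ln q1] has derivative at most
   [|w|], so that [q1] is bounded below by a constant independent of the
   interval; uniform continuity then propagates positivity. *)
Lemma solution_pos (R : realType) (T : R) (w q1 q2 : R -> R) (s : R) :
  solution T w q1 q2 -> 0 < q1 0 ->
  (@lebesgue_measure R).-integrable `[0, T] (EFin \o w) ->
  0 <= s -> s <= T -> 0 < q1 s.
Proof.
move=> [ac1 _ ae1 _] q10 intw.
have [M ME] : exists M, \int[lebesgue_measure]_(t in `[0, T]) `|w t| = M by eexists.
have intaw := integrable_norm intw.
(* The Gronwall lower bound for q1' = w q1, [M] being the L^1 norm of [w]. *)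
pose c := q1 0 * expR (- M).
have c0 : 0 < c by rewrite mulr_gt0// expR_gt0.
have bnd s' : 0 <= s' -> s' <= T ->
    (forall r, 0 <= r -> r <= s' -> 0 < q1 r) -> c <= q1 s'.
  move=> s0 sT qpos.
  have aclnN : abs_continuous 0 s' (fun r => (- 1) * ln (q1 r)).
    apply: abs_continuousM => //; first exact: abs_continuous_cst.
    by apply: abs_continuous_ln => //; apply: abs_continuousS ac1.
  have intaw' : (@lebesgue_measure R).-integrable `[0, s'] (EFin \o (fun t => `|w t|)).
    by apply: integrableS intaw => //; apply: subset_itvl; rewrite bnd_simp.
  have : \int[lebesgue_measure]_(t in `[0, s']) `|w t| <= M.
    rewrite -lee_fin -ME /Rintegral !fineK; [|exact: integrable_fin_num..].
    apply: ge0_subset_integral => //.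
      by move/integrableP: intaw => [].
    by apply: subset_itvl; rewrite bnd_simp.
  have : (- 1) * ln (q1 s') - (- 1) * ln (q1 0) <=
      \int[lebesgue_measure]_(t in `[0, s']) `|w t|.
    apply: (@abs_continuous_increment_le R 0 s' (fun r => (- 1) * ln (q1 r))) => //.
    move: ae1; apply: filterS; first exact: (ae_filter_ringOfSetsType lebesgue_measure).
    move=> r dr rs; have rT : r \in `]0, T[.
      by move: rs; rewrite !in_itv/=; lra.
    move: rs; rewrite in_itv/= => /andP[r0 rs].
    have qr0 : 0 < q1 r by apply: qpos; exact: ltW.
    exists (- 1 * ((q1 r)^-1 * (w r * q1 r))).
      exact: (is_derive1Z _ (is_derive1_chain (is_derive1_ln qr0) (dr rT))).
    by rewrite mulN1r mulrCA mulVf ?gt_eqF// mulr1 -normrN ler_norm.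
  move=> h1 h2; have : ln (q1 0) - M <= ln (q1 s').
    by have := le_trans h1 h2; clear; lra.
  have qs0 : 0 < q1 s' by apply: qpos.
  move=> hln; rewrite /c -[q1 0]lnK ?posrE// -expRD.
  by rewrite -[q1 s']lnK ?posrE// ler_expR.
have c20 : 0 < c / 2 by rewrite divr_gt0.
have [d d0 dP] := abs_continuous_unif ac1 c20.
(* Advance by steps of [d / 2]: from a point where [q1 >= c], uniform continuity keeps [q1 > c / 2]
   over the next step, and [bnd] then restores the bound [c]. *)
have ind n : forall s', 0 <= s' -> s' <= T -> s' <= n%:R * (d / 2) -> c <= q1 s'.
  elim: n => [|n IH] s' s0 sT sn.
    apply: bnd => // r r0 rs; suff -> : r = 0 by [].
    by apply/eqP; rewrite eq_le r0 (le_trans rs)//; move: sn; rewrite mul0r.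
  apply: bnd => // r r0 rs.
  pose r' := Num.max 0 (r - d / 2).
  have r'r : r' <= r by rewrite /r' ge_max r0; lra.
  have r'0 : 0 <= r' by rewrite le_max lexx.
  have r'd : r - d / 2 <= r' by rewrite le_max lexx orbT.
  have : c <= q1 r'.
    apply: IH => //; first by lra.
    rewrite ge_max; apply/andP; split; first by rewrite mulr_ge0//; lra.
    by move: sn; rewrite -natr1; lra.
  have := dP r' r r'0 r'r; rewrite ltr_norml => /(_ _ _)h.
  have {}h : - (c / 2) < q1 r - q1 r' < c / 2 by apply: h; lra.
  lra.
move=> s0 sT; apply: lt_le_trans c0 (ind (Num.bound (s / (d / 2))) s s0 sT _).
rewrite -ler_pdivrMr; last by lra.
by apply/ltW/archi_boundP; rewrite divr_ge0//; lra.
Qed.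

(** Apply the increment bound to [- q2], whose derivative [- q1] is at most 0. *)
Lemma solution_nondecreasing (R : realType) (T : R) (w q1 q2 : R -> R) (s t : R) :
  solution T w q1 q2 -> 0 < q1 0 ->
  (@lebesgue_measure R).-integrable `[0, T] (EFin \o w) ->
  0 <= s -> s <= t -> t <= T -> q2 s <= q2 t.
Proof.
move=> sol q10 intw s0 st tT; have [_ ac2 _ ae2] := sol.
have acN : abs_continuous s t (fun r => (- 1) * q2 r).
  apply: abs_continuousM => //; last exact: abs_continuousS ac2.
  exact: abs_continuous_cst.
have : (- 1) * q2 t - (- 1) * q2 s <=
    \int[lebesgue_measure]_(r in `[s, t]) (cst 0 r).
  apply: (@abs_continuous_increment_le R s t (fun r => (- 1) * q2 r) (cst 0)) => //.
    exact: (@integrable0 _ _ _ lebesgue_measure).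
  move: ae2; apply: filterS; first exact: (ae_filter_ringOfSetsType lebesgue_measure).
  move=> r dr rs; have rT : r \in `]0, T[.
    by move: rs; rewrite !in_itv/=; lra.
  exists ((- 1) * q1 r); first by apply: is_derive1Z; exact: dr.
  have : 0 < q1 r.
    by apply: (solution_pos sol) => //; move: rT; rewrite in_itv/= => /andP[? ?]; exact: ltW.
  by rewrite /=; lra.
by rewrite Rintegral_cst// mul0r; lra.
Qed.

(** Each lower bound on the cost is an instance, with [F] the explicit function adapted to the
    extremal. Infinite cost is trivial; otherwise [w ^+ 2] is integrable and serves as the majorant
    of the derivative. *)
Lemma increment_le_cost (R : realType) (T : R) (w F : R -> R) :
  0 <= T -> (@lebesgue_measure R).-integrable `[0, T] (EFin \o w) ->
  abs_continuous 0 T F ->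
  {ae @lebesgue_measure R, forall s, s \in `]0, T[ ->
     exists2 l, is_derive s (1 : R) F l & l <= w s ^+ 2} ->
  ((F T - F 0)%:E <=
     \int[lebesgue_measure]_(s in `[0%R, T]) (w s ^+ 2)%:E)%E.
Proof.
move=> T0 /integrableP[/measurable_EFinP mw _] acF aeF.
have mw2 : measurable_fun `[0, T] (fun s => w s ^+ 2) by exact: measurable_funX.
have [|] := leP +oo%E (\int[lebesgue_measure]_(s in `[0%R, T]) (w s ^+ 2)%:E)%E.
  by rewrite leye_eq => /eqP ->; rewrite leey.
move=> fin.
have int2 : (@lebesgue_measure R).-integrable `[0, T] (EFin \o (fun s => w s ^+ 2)).
  apply/integrableP; split; first exact/measurable_EFinP.
  by under eq_integral do rewrite /= ger0_norm ?sqr_ge0//.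
have := abs_continuous_increment_le T0 acF (fun s => sqr_ge0 (w s)) int2 aeF.
rewrite -lee_fin /Rintegral fineK//.
by rewrite ge0_fin_numE//; apply: integral_ge0 => s _; rewrite lee_fin sqr_ge0.
Qed.

(** * The linear equation p'' = e p *)

(* [S] and [C] are sinh(k s)/k and cosh(k s), or s and 1, or sin(k s)/k and
   cos(k s), according to the sign of e = k^2, 0 or -k^2. *)
Definition sine_pair (R : realType) (e : R) (S C : R -> R) : Prop :=
  [/\ forall s : R, is_derive s (1 : R) S (C s),
      forall s : R, is_derive s (1 : R) C (e * S s), S 0 = 0 & C 0 = 1].

Lemma sine_pair_pythagoras (R : realType) (e : R) (S C : R -> R) s :
  sine_pair e S C -> C s ^+ 2 - e * S s ^+ 2 = 1.
Proof.
move=> [dS dC S0 C0].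
have -> : C s ^+ 2 - e * S s ^+ 2 = C s * C s - e * (S s * S s) by [].
have : forall t : R,
    is_derive t (1 : R) (fun t => C t * C t - e * (S t * S t)) 0.
  move=> t; apply: is_derive_eq (is_derive1B (is_derive1M (dC t) (dC t))
    (is_derive1Z e (is_derive1M (dS t) (dS t)))) _.
  lra.
by move=> /(@is_derive_0_is_cst _ _ s 0)/= ->; rewrite C0 S0; lra.
Qed.

(** Two combinations of the values at [T - s] and at [s] have zero derivative in [s], hence equal
    [S T] and [C T]. Solving this linear system for [S (T - s)] involves the determinant
    [C s ^+ 2 - e * S s ^+ 2], which is 1. The argument is the same for all signs of [e]. *)
Lemma sine_pair_sub (R : realType) (e : R) (S C : R -> R) T s :
  sine_pair e S C -> S (T - s) = S T * C s - C T * S s.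
Proof.
move=> SC; have [dS dC S0 C0] := SC.
have dr (t : R) : is_derive t (1 : R) (fun t => T - t) (0 - 1).
  exact: is_derive1B (is_derive1_cst _ _) (is_derive1_id _).
have dSr t := @is_derive1_chain R S (fun t => T - t) t _ _ (dS (T - t)) (dr t).
have dCr t := @is_derive1_chain R C (fun t => T - t) t _ _ (dC (T - t)) (dr t).
have ST : S (T - s) * C s + C (T - s) * S s = S T.
  have : forall t : R, is_derive t (1 : R)
      (fun t => S (T - t) * C t + C (T - t) * S t) 0.
    move=> t; apply: is_derive_eq (is_derive1D (is_derive1M (dSr t) (dC t))
      (is_derive1M (dCr t) (dS t))) _.
    lra.
  by move=> /(@is_derive_0_is_cst _ _ s 0)/= ->; rewrite C0 S0 subr0; lra.
have CT : C (T - s) * C s + e * (S (T - s) * S s) = C T.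
  have : forall t : R, is_derive t (1 : R)
      (fun t => C (T - t) * C t + e * (S (T - t) * S t)) 0.
    move=> t; apply: is_derive_eq (is_derive1D (is_derive1M (dCr t) (dC t))
      (is_derive1Z e (is_derive1M (dSr t) (dS t)))) _.
    lra.
  by move=> /(@is_derive_0_is_cst _ _ s 0)/= ->; rewrite C0 S0 subr0; lra.
have := sine_pair_pythagoras s SC => CS.
rewrite -ST -CT -[LHS]mulr1 -CS; lra.
Qed.

Lemma abs_continuous_derivable (R : realType) (a b : R) (f df : R -> R) :
  a <= b -> (forall s, a <= s -> s <= b -> is_derive s (1 : R) f (df s)) ->
  {within `[a, b], continuous df} -> abs_continuous a b f.
Proof.
move=> ab fdf cdf.
by apply: (abs_continuous_comp ab fdf cdf) (abs_continuous_id _ _) => s.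
Qed.

Lemma abs_continuous_derivable2 (R : realType) (a b : R) (f df ddf : R -> R) :
  a <= b -> (forall s : R, is_derive s (1 : R) f (df s)) ->
  (forall s : R, is_derive s (1 : R) df (ddf s)) -> abs_continuous a b f.
Proof.
move=> ab fdf dfddf; apply: (@abs_continuous_derivable R a b f df) => //.
apply: derivable_within_continuous => s _; exact: is_derive1_derivable (dfddf s).
Qed.

(** * The extremal, its cost, and the lower bound for nonpositive energy *)

Section OptimalTrajectory.
Variables (R : realType) (e T ra rb h : R) (S C : R -> R).
Hypotheses (SC : sine_pair e S C) (T0 : 0 < T) (ra0 : 0 < ra) (rb0 : 0 < rb).
Hypotheses (Spos : forall s, 0 < s -> s <= T -> 0 < S s).
Hypothesis hE : h = S T * (ra * rb).

Let d := (ra / rb - C T) / S T.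
Let p s := C s + d * S s.
Let dp s := e * S s + d * C s.

(* [p] solves p'' = e p, with p(0) = 1 and p(T) = ra / rb; the optimal [q1] is
   ra^2 / p^2, with control -2 p'/p, [opt_q2] is its primitive and [opt_mult]
   the multiplier of the constraint on the final value of [q2]. *)
Definition opt_speed s := dp s / p s.
Definition opt_q1 s := ra ^+ 2 / p s ^+ 2.
Definition opt_q2 s := ra ^+ 2 * (S s / p s).
Definition opt_mult := 4 * (d ^+ 2 - e) / ra ^+ 2.

Let k := opt_speed.
Let j := opt_q1.
Let m := opt_q2.
Let lam := opt_mult.

Let ST0 : 0 < S T. Proof. exact: Spos. Qed.

(** By the subtraction formula [p s * S T] equals [S (T - s) + ra / rb * S s], so positivity of [S]
    on ]0, T] passes to [p] even where [C] is negative. *)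
Let p_gt0 s : 0 <= s -> s <= T -> 0 < p s.
Proof.
move=> s0 sT; rewrite -(pmulr_lgt0 _ ST0).
have -> : p s * S T = S (T - s) + ra / rb * S s.
  rewrite (sine_pair_sub _ _ SC) /p mulrDl mulrAC /d divfK ?gt_eqF//; lra.
have r0 : 0 < ra / rb by rewrite divr_gt0.
have [-> | sN0] := eqVneq s 0.
  by have [_ _ -> _] := SC; rewrite mulr0 addr0 subr0.
have Ss : 0 < S s by apply: Spos => //; rewrite lt_neqAle eq_sym sN0.
rewrite ltr_wpDl//; last exact: mulr_gt0.
have [-> | sNT] := eqVneq s T; first by have [_ _ S0 _] := SC; rewrite subrr S0.
by apply/ltW/Spos; rewrite ?subr_gt0 ?lt_neqAle ?sNT//; lra.
Qed.

Let dpP s : is_derive s (1 : R) p (dp s).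
Proof.
have [dS dC _ _] := SC.
exact: is_derive1D (dC s) (is_derive1Z d (dS s)).
Qed.

Let ddpP s : is_derive s (1 : R) dp (e * p s).
Proof.
have [dS dC _ _] := SC.
apply: is_derive_eq (is_derive1D (is_derive1Z e (dS s)) (is_derive1Z d (dC s))) _.
by rewrite /p; lra.
Qed.

(** The Riccati equation attached to p'' = e p. *)
Lemma opt_speed_deriv s : 0 <= s -> s <= T ->
  is_derive s (1 : R) opt_speed (e - opt_speed s ^+ 2).
Proof.
move=> s0 sT; have p0 := p_gt0 s0 sT; have pN0 : p s != 0 by rewrite gt_eqF.
apply: is_derive_eq (is_derive1M (ddpP s) (is_derive1V pN0 (dpP s))) _.
rewrite mulfK//; congr (_ + _).
by rewrite /opt_speed exprMn exprVn mulrA mulrN mulNr expr2.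
Qed.

(** [S] and [p] solve the same linear equation, with Wronskian [C s * p s - S s * dp s] equal to 1;
    hence S/p has derivative 1/p^2. *)
Lemma opt_q2_deriv s : 0 <= s -> s <= T ->
  is_derive s (1 : R) opt_q2 (opt_q1 s).
Proof.
move=> s0 sT; have p0 := p_gt0 s0 sT; have pN0 : p s != 0 by rewrite gt_eqF.
have [dS _ _ _] := SC.
apply: is_derive_eq (is_derive1Z (ra ^+ 2)
  (is_derive1M (dS s) (is_derive1V pN0 (dpP s)))) _.
rewrite /opt_q1; congr (_ * _).
have CS := sine_pair_pythagoras s SC.
have -> : (p s)^-1 = p s / p s ^+ 2 by rewrite expr2 invfM mulrA mulfV// mul1r.
have : C s * p s - S s * dp s = 1 by rewrite -CS /p /dp; lra.
by set i := (p s ^+ 2)^-1 => CpS; rewrite -[RHS]mul1r -CpS; lra.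
Qed.

Lemma opt_q1_deriv s : 0 <= s -> s <= T ->
  is_derive s (1 : R) opt_q1 (- 2 * opt_speed s * opt_q1 s).
Proof.
move=> s0 sT; have p0 := p_gt0 s0 sT; have pN0 : p s != 0 by rewrite gt_eqF.
have p2N0 : p s * p s != 0 by rewrite mulf_neq0.
have -> : opt_q1 = (fun s => ra ^+ 2 * (p s * p s)^-1) by [].
apply: is_derive_eq (is_derive1Z (ra ^+ 2)
  (@is_derive1V R (fun s => p s * p s) s _ p2N0 (is_derive1M (dpP s) (dpP s)))) _.
rewrite /opt_q1 /opt_speed -!exprVn !invfM; set i := (p s)^-1.
have pi : p s * i = 1 by rewrite mulfV.
by rewrite -[RHS]mulr1 -[X in _ = _ * X]pi; lra.
Qed.

Lemma opt_lnp_deriv s : 0 <= s -> s <= T ->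
  is_derive s (1 : R) (fun s => ln (p s)) (opt_speed s).
Proof.
move=> s0 sT; have p0 := p_gt0 s0 sT.
apply: is_derive_eq (@is_derive1_chain R _ p s _ _ (is_derive1_ln p0) (dpP s)) _.
by rewrite mulrC.
Qed.

(** The first integral [dp s ^+ 2 - e * p s ^+ 2 = d ^+ 2 - e], divided by [p s ^+ 2]: this is u'^2
    - lam e^u = E with E = 4 e. *)
Lemma opt_multE s : 0 <= s -> s <= T ->
  opt_mult * opt_q1 s = 4 * opt_speed s ^+ 2 - 4 * e.
Proof.
move=> s0 sT; have p0 := p_gt0 s0 sT; have pN0 : p s != 0 by rewrite gt_eqF.
have ra2 : ra ^+ 2 != 0 by rewrite expf_neq0// gt_eqF.
rewrite /opt_mult /opt_q1 mulrA divfK//.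
have -> : opt_speed s ^+ 2 = dp s ^+ 2 / p s ^+ 2 by rewrite -exprVn -exprMn.
set i := (p s ^+ 2)^-1.
have pi : p s ^+ 2 * i = 1 by rewrite mulfV// expf_neq0.
have CS := sine_pair_pythagoras s SC.
have dpE : dp s ^+ 2 - e * p s ^+ 2 = (d ^+ 2 - e).
  by rewrite -[RHS]mulr1 -CS /dp /p; lra.
rewrite -[4 * e]mulr1 -[X in 4 * e * X]pi -dpE; lra.
Qed.

Lemma opt_end : [/\ opt_q1 0 = ra ^+ 2, opt_q1 T = rb ^+ 2, opt_q2 0 = 0 & opt_q2 T = h].
Proof.
have [_ _ S0 C0] := SC.
have p0 : p 0 = 1 by rewrite /p S0 C0 mulr0 addr0.
have pT : p T = ra / rb by rewrite /p /d divfK ?gt_eqF//; lra.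
rewrite /opt_q1 /opt_q2 p0 pT S0 mul0r mulr0 expr1n divr1 hE.
have ra1 : ra != 0 by rewrite gt_eqF.
have rb1 : rb != 0 by rewrite gt_eqF.
split => //.
  by rewrite exprMn exprVn invfM invrK mulrA divff ?mul1r// expf_neq0.
rewrite invfM invrK expr2.
have -> : ra * ra * (S T * (ra^-1 * rb)) = (ra * ra^-1) * (S T * (ra * rb)) by lra.
by rewrite divff ?mul1r.
Qed.

(** Both [d] and [e] are eliminated: [d * h] is [ra ^+ 2 - C T * ra * rb], and [e * S T ^+ 2] is
    [C T ^+ 2 - 1]. *)
Lemma opt_multh :
  opt_mult * h = 4 * (ra ^+ 2 + rb ^+ 2) / h - 8 * (ra * rb) * C T / h.
Proof.
have CS := sine_pair_pythagoras T SC.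
have ra1 : ra != 0 by rewrite gt_eqF.
have rb1 : rb != 0 by rewrite gt_eqF.
have h0 : h != 0 by rewrite hE gt_eqF// !mulr_gt0.
apply: (mulIf h0); rewrite mulrBl !divfK//.
have dE : d * h = ra ^+ 2 - C T * ra * rb.
  have dS : d * S T = ra / rb - C T by rewrite divfK ?gt_eqF.
  have rbi : rb^-1 * rb = 1 by rewrite mulVf.
  by rewrite hE mulrA dS -[ra ^+ 2]mulr1 -[X in _ = _ * X - _]rbi; lra.
have -> : opt_mult * h * h = 4 * ((d * h) ^+ 2 - e * h ^+ 2) / ra ^+ 2.
  by rewrite /opt_mult; lra.
apply: (canLR (mulfK _)); first by rewrite expf_neq0.
rewrite dE hE.
have : e * (S T) ^+ 2 = C T ^+ 2 - 1 by lra.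
have -> : e * (S T * (ra * rb)) ^+ 2 = (e * S T ^+ 2) * (ra * rb) ^+ 2 by lra.
by move=> ->; lra.
Qed.

Let acp : abs_continuous 0 T p.
Proof. exact: abs_continuous_derivable2 (ltW T0) dpP ddpP. Qed.

Let acS : abs_continuous 0 T S.
Proof. by have [dS dC _ _] := SC; exact: abs_continuous_derivable2 (ltW T0) dS dC. Qed.

Let aci : abs_continuous 0 T (fun s => (p s)^-1).
Proof. exact: abs_continuous_inv (ltW T0) p_gt0 acp. Qed.

Lemma opt_speed_ac : abs_continuous 0 T opt_speed.
Proof.
have [dS dC _ _] := SC; apply: abs_continuousM aci; first exact: ltW.
by apply: abs_continuous_derivable2 (ltW T0) ddpP _ => s; exact: is_derive1Z (dpP s).
Qed.

Lemma opt_q2_ac : abs_continuous 0 T opt_q2.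
Proof.
apply: abs_continuousM (abs_continuous_cst _ _ _) _; first exact: ltW.
by apply: abs_continuousM acS aci; exact: ltW.
Qed.

Lemma opt_q1_ac : abs_continuous 0 T opt_q1.
Proof.
have -> : opt_q1 = (fun s => ra ^+ 2 * ((p s)^-1 * (p s)^-1)).
  by apply/funext => s; rewrite /opt_q1 -exprVn.
apply: abs_continuousM (abs_continuous_cst _ _ _) _; first exact: ltW.
by apply: abs_continuousM aci aci; exact: ltW.
Qed.

Lemma opt_solution (y : R) :
  solution T (fun s => - 2 * opt_speed s) opt_q1 (fun s => y + opt_q2 s).
Proof.
split.
- exact: opt_q1_ac.
- by apply: abs_continuousD (abs_continuous_cst _ _ _) opt_q2_ac.
- apply: aeW => s; rewrite in_itv/= => /andP[s0 sT].
  by apply: opt_q1_deriv; exact: ltW.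
- apply: aeW => s; rewrite in_itv/= => /andP[s0 sT].
  rewrite -[X in is_derive _ _ _ X]add0r.
  by apply: is_derive1D (is_derive1_cst _ _) _; apply: opt_q2_deriv; exact: ltW.
Qed.

Lemma opt_integrable :
  (@lebesgue_measure R).-integrable `[0, T] (EFin \o (fun s => - 2 * opt_speed s)).
Proof.
apply: continuous_compact_integrable; first exact: segment_compact.
apply: derivable_within_continuous => s; rewrite in_itv/= => /andP[s0 sT].
exact: is_derive1_derivable (is_derive1Z (- 2) (opt_speed_deriv s0 sT)).
Qed.

(** By [opt_multE] the integrand is the derivative of [4 * e * s + opt_mult * opt_q2 s]. *)
Lemma opt_cost :
  (\int[lebesgue_measure]_(s in `[0%R, T]) ((- 2 * opt_speed s) ^+ 2)%:E =
   (4 * e * T + opt_mult * h)%:E)%E.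
Proof.
have dF (s : R) : 0 <= s -> s <= T -> is_derive s (1 : R)
    (fun s => 4 * e * s + opt_mult * opt_q2 s) ((- 2 * opt_speed s) ^+ 2).
  move=> s0 sT; apply: is_derive_eq (is_derive1D
    (is_derive1Z _ (is_derive1_id _)) (is_derive1Z _ (opt_q2_deriv s0 sT))) _.
  by rewrite opt_multE//; lra.
have [_ _ q20 q2T] := opt_end.
have cF : {within `[0, T], continuous (fun s => 4 * e * s + opt_mult * opt_q2 s)}.
  apply: derivable_within_continuous => s; rewrite in_itv/= => /andP[s0 sT].
  exact: is_derive1_derivable (dF s s0 sT).
have -> := @continuous_FTC2 R (fun s => (- 2 * opt_speed s) ^+ 2)
  (fun s => 4 * e * s + opt_mult * opt_q2 s) 0 T T0.
- by rewrite q20 q2T -EFinB; congr EFin; lra.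
- apply: derivable_within_continuous => s; rewrite in_itv/= => /andP[s0 sT].
  have dk := is_derive1Z (- 2) (opt_speed_deriv s0 sT).
  exact: is_derive1_derivable (is_derive1M dk dk).
- split.
  + move=> s; rewrite in_itv/= => /andP[/ltW s0 /ltW sT].
    exact: is_derive1_derivable (dF s s0 sT).
  + by have /(continuous_within_itvP _ T0)[] := cF.
  + by have /(continuous_within_itvP _ T0)[] := cF.
- move=> s; rewrite in_itv/= => /andP[/ltW s0 /ltW sT].
  by rewrite derive1E; have [_ ->] := dF s s0 sT.
Qed.

(* Convexity of [u'^2 + lam e^u] in [u = ln q1], where [lam >= 0]. *)
Lemma opt_lower_bound_le0 (w q1 q2 : R -> R) (y : R) : e <= 0 ->
  (@lebesgue_measure R).-integrable `[0, T] (EFin \o w) ->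
  solution T w q1 q2 -> q1 0 = ra ^+ 2 -> q2 0 = y ->
  q1 T = rb ^+ 2 -> q2 T = y + h ->
  ((4 * e * T + opt_mult * h)%:E <=
   \int[lebesgue_measure]_(s in `[0%R, T]) (w s ^+ 2)%:E)%E.
Proof.
move=> e0 intw sol q10 q20 q1T q2T.
have [ac1 ac2 ae1 ae2] := sol.
have T0' := ltW T0.
have ra2 : 0 < ra ^+ 2 by rewrite exprn_gt0.
have q1pos s : 0 <= s -> s <= T -> 0 < q1 s.
  by move=> s0 sT; apply: (solution_pos sol) => //; rewrite q10.
have lam0 : 0 <= opt_mult.
  apply: divr_ge0; last exact: ltW.
  by apply: mulr_ge0 => //; rewrite subr_ge0; exact: le_trans e0 (sqr_ge0 _).
(* [L s - c0] is [ln (q1 s / opt_q1 s)], the deviation of u from the extremal; it vanishes at both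
   ends. *)
pose L s := ln (q1 s) + 2 * ln (p s).
pose c0 := ln (ra ^+ 2).
(* With v the extremal value of u, the first term is 2 v' (u - v); as 2 v'' = lam e^v, its
   derivative is the linear part of the convexity inequality. The rest is a primitive of v'^2 + lam
   e^v - lam e^u, where v'^2 = 4 e + lam e^v. *)
pose F s := (- 4) * (opt_speed s * (L s - c0)) + (4 * e * s +
  (2 * opt_mult * opt_q2 s + (- opt_mult) * q2 s)).
have [j0 jT m0 mT] := opt_end.
have end0 s : q1 s = opt_q1 s -> 0 <= s -> s <= T -> L s = c0.
  move=> qs s0 sT; have p0 := p_gt0 s0 sT.
  rewrite /L qs /opt_q1 /c0 ln_div ?posrE ?exprn_gt0// (lnXn 2 p0).
  by rewrite mulr2n; lra.
have F0T : F T - F 0 = 4 * e * T + opt_mult * h.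
  by rewrite /F !end0 ?q10 ?q1T// m0 mT q20 q2T; lra.
rewrite -F0T; apply: increment_le_cost => //.
  have acL : abs_continuous 0 T (fun s => L s - c0).
    apply: abs_continuousD (abs_continuous_cst _ _ _).
    apply: abs_continuousD; first exact: abs_continuous_ln ac1.
    apply: abs_continuousM (abs_continuous_cst _ _ _) _ => //.
    exact: abs_continuous_ln acp.
  apply: abs_continuousD.
    apply: abs_continuousM (abs_continuous_cst _ _ _) _ => //.
    exact: abs_continuousM opt_speed_ac acL.
  apply: abs_continuousD.
    by apply: abs_continuousM (abs_continuous_cst _ _ _) (abs_continuous_id _ _).
  apply: abs_continuousD.
    by apply: abs_continuousM (abs_continuous_cst _ _ _) opt_q2_ac.
  by apply: abs_continuousM (abs_continuous_cst _ _ _) ac2.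
move: ae1 ae2; apply: filterS2.
  exact: (ae_filter_ringOfSetsType lebesgue_measure).
move=> s d1 d2 sT; move: (sT); rewrite in_itv/= => /andP[/ltW s0 /ltW sT'].
have q1s := q1pos s s0 sT'; have ps := p_gt0 s0 sT'.
have dlnq := @is_derive1_chain R _ q1 s _ _ (is_derive1_ln q1s) (d1 sT).
have dL := is_derive1B (is_derive1D dlnq (is_derive1Z 2 (opt_lnp_deriv s0 sT')))
  (is_derive1_cst c0 s).
have dF := is_derive1D (is_derive1Z (- 4) (is_derive1M (opt_speed_deriv s0 sT') dL))
  (is_derive1D (is_derive1Z (4 * e) (is_derive1_id s))
  (is_derive1D (is_derive1Z (2 * opt_mult) (opt_q2_deriv s0 sT'))
  (is_derive1Z (- opt_mult) (d2 sT)))).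
eexists; first exact: dF.
rewrite mulrCA mulVf ?gt_eqF// mulr1 -/(L s).
have rel := opt_multE s0 sT'.
have js : 0 < opt_q1 s by rewrite divr_gt0// exprn_gt0.
(* The tangent bound for the exponential at the extremal; with the square introduced below it makes
   up the whole convexity inequality. *)
have expL : opt_q1 s * (1 + (L s - c0)) <= q1 s.
  rewrite mulrC -ler_pdivlMr//; apply: le_trans (expR_ge1Dx _) _.
  rewrite /L /c0 (_ : _ - _ = ln (q1 s / opt_q1 s)); last first.
    by rewrite !ln_div ?posrE ?divr_gt0 ?exprn_gt0// (lnXn 2 ps) mulr2n; lra.
  by rewrite lnK// posrE divr_gt0.
have := ler_wpM2l lam0 expL; have := sqr_ge0 (w s + 2 * opt_speed s).
move: rel; set k' := opt_speed s; set j' := opt_q1 s; set l := L s - c0.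
set la := opt_mult => rel sq.
have rell : la * j' * l = (4 * k' ^+ 2 - 4 * e) * l by rewrite rel.
lra.
Qed.

End OptimalTrajectory.

(** * The lower bound for positive energy *)

Lemma abs_continuous_expR (R : realType) (a b : R) (f : R -> R) :
  a <= b -> abs_continuous a b f -> abs_continuous a b (fun s => expR (f s)).
Proof.
move=> ab acf; have [M M0 fM] := abs_continuous_bounded ab acf.
apply: (@abs_continuous_comp R a b f expR expR (- M) M) => //; first by lra.
- by apply: continuous_subspaceT; exact: continuous_expR.
- by move=> s a_s sb; apply/andP; rewrite -ler_norml; exact: fM.
Qed.

(** The right side minus the left is exactly [(w - D * r) ^+ 2 + 4 * k ^+ 2 * ((1 - r) ^+ 2 * (1 + 2
    * r))]. It vanishes on the extremal, where r = 1 and w = D. *)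
Lemma quadratic_field_ineq (R : realType) (w r D k : R) : 0 <= r ->
  4 * (r ^+ 2 * (D ^+ 2 - 4 * k ^+ 2) / 2 * (r - 1) +
       D * r * (w - r ^+ 2 * D) / 2) +
  r ^+ 2 * (D ^+ 2 - 4 * k ^+ 2) + 8 * k ^+ 2 * r ^+ 2 - 4 * k ^+ 2 <= w ^+ 2.
Proof.
move=> r0; have := sqr_ge0 (w - D * r).
have : 0 <= k ^+ 2 * ((1 - r) ^+ 2 * (1 + 2 * r)).
  by apply: mulr_ge0 (sqr_ge0 _) (mulr_ge0 (sqr_ge0 _) _); lra.
lra.
Qed.

(* With [tau = q2 - y] as time and [z = sqrt q1], the cost is
   4 * int (dz/dtau)^2 under the constraint int dtau / z^2 = T, and
   4 z'^2 + 4 k^2 / z^2 is convex in (z', z). The extremal is z^2 = ra^2 A B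
   with [A] and [B] affine. *)
Lemma lower_bound_gt0 (R : realType) (k T ra rb h y : R) (w q1 q2 : R -> R) :
  0 < k -> 0 < T -> 0 < ra -> 0 < rb -> 0 < h ->
  2 * k * h = ra * rb * (expR (k * T) - expR (- (k * T))) ->
  (@lebesgue_measure R).-integrable `[0, T] (EFin \o w) ->
  solution T w q1 q2 -> q1 0 = ra ^+ 2 -> q2 0 = y ->
  q1 T = rb ^+ 2 -> q2 T = y + h ->
  ((4 * k ^+ 2 * T + (4 * (ra ^+ 2 + rb ^+ 2) / h -
      4 * (ra * rb) * (expR (k * T) + expR (- (k * T))) / h))%:E <=
   \int[lebesgue_measure]_(s in `[0%R, T]) (w s ^+ 2)%:E)%E.
Proof.
move=> k0 T0 ra0 rb0 h0 hE intw sol q10 q20 q1T q2T.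
have [ac1 ac2 ae1 ae2] := sol.
have T0' := ltW T0.
have x0 : 0 < ra ^+ 2 by rewrite exprn_gt0.
have q10' : 0 < q1 0 by rewrite q10.
have q1pos s : 0 <= s -> s <= T -> 0 < q1 s by move=> ? ?; exact: (solution_pos sol).
have q2itv s : 0 <= s -> s <= T -> 0 <= q2 s - y /\ q2 s - y <= h.
  move=> s0 sT.
  have := solution_nondecreasing sol q10' intw s0 sT (lexx _).
  have := solution_nondecreasing sol q10' intw (lexx _) s0 sT.
  by rewrite q20 q2T; lra.
set X := expR (k * T) in hE *; set Y := expR (- (k * T)) in hE *.
have X0 : 0 < X by exact: expR_gt0.
have Y0 : 0 < Y by exact: expR_gt0.
have XY : X * Y = 1 by rewrite -expRD subrr expR0.
pose al := rb / ra.
have al0 : 0 < al by rewrite divr_gt0.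
have alra : al * ra = rb by rewrite divfK// gt_eqF.
have hN0 : h != 0 by rewrite gt_eqF.
(* [A] and [B] equal 1 at tau = 0, and [al * X] and [al * Y] at tau = h, so ra^2 A B goes from ra^2
   to rb^2. The difference of slopes [2 * k / ra ^+ 2] makes (ln A - ln B)/(2 k) the time elapsed
   along the extremal. *)
pose m1 := (al * X - 1) / h; pose m2 := (al * Y - 1) / h.
have m1h : m1 * h = al * X - 1 by rewrite divfK.
have m2h : m2 * h = al * Y - 1 by rewrite divfK.
have m12 : ra ^+ 2 * (m1 - m2) = 2 * k.
  apply: (mulIf hN0); rewrite hE.
  have -> : ra ^+ 2 * (m1 - m2) * h = ra ^+ 2 * (m1 * h - m2 * h) by lra.
  by rewrite m1h m2h -alra; lra.
pose q s := q2 s - y; pose A s := 1 + m1 * q s; pose B s := 1 + m2 * q s.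
have affine_pos m c s : 0 < c -> m * h = c - 1 -> 0 <= s -> s <= T ->
    0 < 1 + m * q s.
  move=> c0 mh s0 sT; have [qs0 qsh] := q2itv s s0 sT.
  rewrite -(pmulr_lgt0 _ h0).
  have -> : (1 + m * q s) * h = (h - q s) + c * q s by rewrite mulrDl mulrAC mh; lra.
  have [->|qN0] := eqVneq (q s) 0; first by lra.
  by rewrite ltr_wpDl ?subr_ge0// mulr_gt0// lt_neqAle eq_sym qN0.
have Apos s : 0 <= s -> s <= T -> 0 < A s.
  by apply: (affine_pos m1 (al * X)) => //; rewrite mulr_gt0.
have Bpos s : 0 <= s -> s <= T -> 0 < B s.
  by apply: (affine_pos m2 (al * Y)) => //; rewrite mulr_gt0.
(* [D] is the tau-derivative of ra^2 A B, and [r] below is the ratio of z to its extremal value at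
   the same tau, written through logarithms so that it is absolutely continuous by composition. *)
pose D s := ra ^+ 2 * (m1 * B s + m2 * A s).
pose rho s := ln (q1 s) - ln (ra ^+ 2) - ln (A s) - ln (B s).
pose r s := expR (1 / 2 * rho s).
have lnAB s : 0 <= s -> s <= T ->
    ln (ra ^+ 2 * A s * B s) = ln (ra ^+ 2) + ln (A s) + ln (B s).
  move=> s0 sT; have As := Apos s s0 sT; have Bs := Bpos s s0 sT.
  by rewrite lnM ?posrE ?mulr_gt0// (@lnM _ (ra ^+ 2)) ?posrE.
have r2E s : 0 <= s -> s <= T -> q1 s = r s ^+ 2 * (ra ^+ 2 * A s * B s).
  move=> s0 sT; have q1s := q1pos s s0 sT; have As := Apos s s0 sT; have Bs := Bpos s s0 sT.
  rewrite /r expr2 -expRD (_ : _ + _ = ln (q1 s / (ra ^+ 2 * A s * B s))).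
    by rewrite lnK ?posrE ?divr_gt0 ?mulr_gt0// divfK// gt_eqF// !mulr_gt0.
  by rewrite ln_div ?posrE ?mulr_gt0// lnAB// /rho; lra.
pose lam := 4 * ra ^+ 2 * m1 * m2.
(* With v the extremal value of z, the first term is 8 v' (z - v), the linear part of the convexity
   inequality. Next, 4 v'^2 + 4 k^2/v^2 equals lam + 8 k^2/v^2, with primitive lam tau + 4 k (ln A -
   ln B). The last term subtracts 4 k^2 times the elapsed time, the integral of 4 k^2/z^2. *)
pose F s := 4 * (D s * (r s - 1)) + (lam * q s +
  (4 * k * (ln (A s) - ln (B s)) + (- (4 * k ^+ 2)) * s)).
have rend s : q1 s = ra ^+ 2 * A s * B s -> 0 <= s -> s <= T -> r s = 1.
  move=> qE s0 sT; have As := Apos s s0 sT; have Bs := Bpos s s0 sT.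
  rewrite /r /rho qE lnAB// (_ : 1 / 2 * _ = 0) ?expR0//; lra.
have qz : q 0 = 0 by rewrite /q q20 subrr.
have qT : q T = h by rewrite /q q2T; lra.
have Az : A 0 = 1 by rewrite /A qz mulr0 addr0.
have Bz : B 0 = 1 by rewrite /B qz mulr0 addr0.
have AT : A T = al * X by rewrite /A qT m1h; lra.
have BT : B T = al * Y by rewrite /B qT m2h; lra.
have lamh : lam * h = 4 * (ra ^+ 2 + rb ^+ 2) / h - 4 * (ra * rb) * (X + Y) / h.
  apply: (mulIf hN0); rewrite mulrBl !divfK//.
  have -> : lam * h * h = 4 * ra ^+ 2 * (m1 * h) * (m2 * h) by rewrite /lam; lra.
  rewrite m1h m2h -alra -[in RHS](mulr1 ((al * ra) ^+ 2)).
  by rewrite -[X in _ = 4 * (_ + _ * X) - _]XY; lra.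
have F0T : F T - F 0 = 4 * k ^+ 2 * T + (4 * (ra ^+ 2 + rb ^+ 2) / h -
      4 * (ra * rb) * (X + Y) / h).
  rewrite -lamh /F !rend ?Az ?Bz ?AT ?BT ?qz ?qT ?mulr1//; last first.
    rewrite q1T -alra -[LHS]mulr1 -[X in _ * X]XY; lra.
  by rewrite ln1 !(@lnM _ al) ?posrE// /X /Y !expRK; lra.
rewrite -F0T; apply: increment_le_cost => //.
  have acq : abs_continuous 0 T q by exact: abs_continuousD ac2 (abs_continuous_cst _ _ _).
  have acaff m : abs_continuous 0 T (fun s => 1 + m * q s).
    apply: abs_continuousD (abs_continuous_cst _ _ _) _.
    by apply: abs_continuousM (abs_continuous_cst _ _ _) acq.
  have acA : abs_continuous 0 T (fun s => ln (A s)) by exact: abs_continuous_ln (acaff m1).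
  have acB : abs_continuous 0 T (fun s => ln (B s)) by exact: abs_continuous_ln (acaff m2).
  have acD : abs_continuous 0 T D.
    apply: abs_continuousM (abs_continuous_cst _ _ _) _ => //.
    by apply: abs_continuousD; apply: abs_continuousM (abs_continuous_cst _ _ _) (acaff _).
  have acr : abs_continuous 0 T (fun s => r s - 1).
    apply: abs_continuousB (abs_continuous_cst _ _ _); apply: abs_continuous_expR => //.
    apply: abs_continuousM (abs_continuous_cst _ _ _) _ => //.
    apply: abs_continuousB acB; apply: abs_continuousB acA; apply: abs_continuousB (abs_continuous_cst _ _ _).
    exact: abs_continuous_ln ac1.
  apply: abs_continuousD.
    apply: abs_continuousM (abs_continuous_cst _ _ _) _ => //.
    exact: abs_continuousM acD acr.
  apply: abs_continuousD; first by apply: abs_continuousM (abs_continuous_cst _ _ _) acq.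
  apply: abs_continuousD.
    by apply: abs_continuousM (abs_continuous_cst _ _ _) (abs_continuousB acA acB).
  by apply: abs_continuousM (abs_continuous_cst _ _ _) (abs_continuous_id _ _).
move: ae1 ae2; apply: filterS2.
  exact: (ae_filter_ringOfSetsType lebesgue_measure).
move=> s d1 d2 sT; move: (sT); rewrite in_itv/= => /andP[/ltW s0 /ltW sT'].
have q1s := q1pos s s0 sT'; have As := Apos s s0 sT'; have Bs := Bpos s s0 sT'.
have dq := is_derive1B (d2 sT) (is_derive1_cst y s).
have dA := is_derive1D (is_derive1_cst 1 s) (is_derive1Z m1 dq).
have dB := is_derive1D (is_derive1_cst 1 s) (is_derive1Z m2 dq).
have dlnA := @is_derive1_chain R (@ln R) A s _ _ (is_derive1_ln As) dA.
have dlnB := @is_derive1_chain R (@ln R) B s _ _ (is_derive1_ln Bs) dB.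
have dlnq := @is_derive1_chain R (@ln R) q1 s _ _ (is_derive1_ln q1s) (d1 sT).
have drho := is_derive1B (is_derive1B (is_derive1B dlnq
  (is_derive1_cst (ln (ra ^+ 2)) s)) dlnA) dlnB.
have dr := @is_derive1_chain R (@expR R) (fun s => 1 / 2 * rho s) s _ _
  (is_derive_expR _) (is_derive1Z (1 / 2) drho).
have dD := is_derive1Z (ra ^+ 2) (is_derive1D (is_derive1Z m1 dB) (is_derive1Z m2 dA)).
have dF := is_derive1D (is_derive1Z 4 (is_derive1M dD (is_derive1B dr (is_derive1_cst 1 s))))
  (is_derive1D (is_derive1Z lam dq) (is_derive1D (is_derive1Z (4 * k) (is_derive1B dlnA dlnB))
  (is_derive1Z (- (4 * k ^+ 2)) (is_derive1_id s)))).
eexists; first exact: dF.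
move=> {dF dD dr drho dlnq dlnA dlnB dA dB dq hE F0T lamh rend qz qT Az Bz AT BT lnAB}.
have r0 : 0 <= r s by exact: expR_ge0.
apply: le_trans (quadratic_field_ineq (w s) (D s) k r0).
rewrite -/(r s) -/(A s) -/(B s) -/(D s) -/(r s).
have qw : (q1 s)^-1 * (w s * q1 s) = w s by rewrite mulrCA mulVf ?gt_eqF// mulr1.
have qA : (A s)^-1 * q1 s = r s ^+ 2 * (ra ^+ 2 * B s).
  rewrite (r2E s s0 sT') -[RHS]mulr1 -[X in _ = _ * X](mulVf (lt0r_neq0 As)); lra.
have qB : (B s)^-1 * q1 s = r s ^+ 2 * (ra ^+ 2 * A s).
  rewrite (r2E s s0 sT') -[RHS]mulr1 -[X in _ = _ * X](mulVf (lt0r_neq0 Bs)); lra.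
have P12 : ra ^+ 2 * m1 * B s - ra ^+ 2 * m2 * A s = 2 * k by rewrite -m12 /A /B; lra.
(* The energy identity of the extremal: [D s] is the sum, and [2 * k] by [P12] the difference, of
   [ra ^+ 2 * m1 * B s] and [ra ^+ 2 * m2 * A s]. *)
have mmq : 4 * (ra ^+ 2 * m1 * m2 * q1 s) = r s ^+ 2 * (D s ^+ 2 - 4 * k ^+ 2).
  have -> : 4 * k ^+ 2 = (ra ^+ 2 * m1 * B s - ra ^+ 2 * m2 * A s) ^+ 2 by rewrite P12; lra.
  rewrite (r2E s s0 sT') /D; lra.
have uA : (A s)^-1 * (0 + m1 * (q1 s - 0)) = r s ^+ 2 * (ra ^+ 2 * m1 * B s).
  transitivity (m1 * ((A s)^-1 * q1 s)); first by lra.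
  by rewrite qA; lra.
have uB : (B s)^-1 * (0 + m2 * (q1 s - 0)) = r s ^+ 2 * (ra ^+ 2 * m2 * A s).
  transitivity (m2 * ((B s)^-1 * q1 s)); first by lra.
  by rewrite qB; lra.
rewrite qw uA uB.
have -> : ra ^+ 2 * (m1 * (0 + m2 * (q1 s - 0)) + m2 * (0 + m1 * (q1 s - 0))) =
    r s ^+ 2 * (D s ^+ 2 - 4 * k ^+ 2) / 2 by rewrite -mmq; lra.
have -> : lam * (q1 s - 0) = r s ^+ 2 * (D s ^+ 2 - 4 * k ^+ 2) by rewrite -mmq /lam; lra.
have -> : w s - 0 - r s ^+ 2 * (ra ^+ 2 * m1 * B s) - r s ^+ 2 * (ra ^+ 2 * m2 * A s) =
   w s - r s ^+ 2 * D s by rewrite /D; lra.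
have -> : r s ^+ 2 * (ra ^+ 2 * m1 * B s) - r s ^+ 2 * (ra ^+ 2 * m2 * A s) =
   r s ^+ 2 * (2 * k) by rewrite -P12; lra.
lra.
Qed.

(** * Elementary bounds and the inverse of [g] *)

(** From e^(-2 s) >= 1 - 2 s. In terms of [g] it reads g(k^2) <= e^k. *)
Lemma ler_sinh_mul_expR (R : realType) (s : R) : 0 <= s ->
  expR s - expR (- s) <= 2 * (s * expR s).
Proof.
move=> s0.
have -> : expR (- s) = expR s * expR (- (2 * s)) by rewrite -expRD; congr expR; lra.
have := expR_ge1Dx (- (2 * s)) => h.
have := ler_wpM2l (expR_ge0 s) h; lra.
Qed.

(** Square 1 + s/2 <= e^(s/2). The quadratic term is what exceeds 2 rho s at s = 8 rho. *)
Lemma ler_mul_sinh (R : realType) (s : R) : 0 <= s ->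
  s + s ^+ 2 / 4 <= expR s - expR (- s).
Proof.
move=> s0.
have h1 : 1 + s / 2 <= expR (s / 2) by exact: expR_ge1Dx.
have hs : expR s = expR (s / 2) ^+ 2 by rewrite expr2 -expRD; congr expR; lra.
have h2 : expR (- s) <= 1 by rewrite -expR0 ler_expR; lra.
have : (1 + s / 2) ^+ 2 <= expR (s / 2) ^+ 2 by rewrite ler_sqr ?nnegrE//; lra.
rewrite -hs; lra.
Qed.

Lemma ler_mul_cos_sin (R : realType) (s : R) : 0 <= s -> s <= pi ->
  s * cos s <= sin s.
Proof.
move=> s0 spi.
have [c|c cs] := @MVT_segment R sin cos 0 s s0.
  by apply: continuous_subspaceT; exact: continuous_sin.
rewrite sin0 !subr0 => ->; rewrite mulrC; apply: ler_wpM2r => //.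
move: cs; rewrite in_itv/= => /andP[c0 cs].
by rewrite leNgt ltr_cos ?in_itv/= -?leNgt ?c0 ?s0 ?(le_trans cs).
Qed.

Section GInverse.
Variable R : realType.
Implicit Types (r rho k : R).

Lemma g_sinh k : 0 < k -> @g R (k ^+ 2) = (expR k - expR (- k)) / 2 / k.
Proof.
by move=> k0; rewrite /g exprn_gt0// sqrtr_sqr gtr0_norm.
Qed.

Lemma g_sin k : 0 < k -> @g R (- k ^+ 2) = sin k / k.
Proof.
move=> k0; have k2 : 0 < k ^+ 2 by rewrite exprn_gt0.
rewrite /g ltNge oppr_le0 (ltW k2)/= oppr_eq0 gt_eqF//.
by rewrite opprK sqrtr_sqr gtr0_norm.
Qed.

Lemma g0 : @g R 0 = 1.
Proof. by rewrite /g ltxx eqxx. Qed.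

(** Intermediate values on explicit brackets for sqrt |r|: [ln rho, 8 rho] if rho > 1 and
    [acos rho, pi] if rho < 1, the preceding inequalities giving the signs at the ends. Surjectivity
    makes [pinv] a right inverse of [g]. *)
Lemma g_surj : set_surj `]- pi ^+ 2, +oo[ [set rho | 0 < rho] (@g R).
Proof.
move=> rho /= rho0; have p0 := pi_gt0 R.
have p2 : 0 < (pi : R) ^+ 2 by rewrite exprn_gt0.
have [rho1|rho1|->] := ltgtP rho 1; last first.
- by exists 0; rewrite ?g0//= in_itv/= andbT; lra.
- pose f (s : R) := expR s - expR (- s) - 2 * rho * s.
  have l0 : 0 < ln rho by rewrite ln_gt0.
  have lrho : ln rho <= 8 * rho.
    by have := ln_sublinear rho0; lra.
  have cf : {within `[ln rho, 8 * rho], continuous f}.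
    apply: derivable_within_continuous => s _.
    have dN := @is_derive1_chain R (@expR R) (fun s => (- 1) * s) s _ _
      (is_derive_expR _) (is_derive1Z (- 1) (is_derive1_id s)).
    have -> : f = (fun s => expR s - expR ((- 1) * s) - 2 * rho * s).
      by apply/funext => u; rewrite /f mulN1r.
    exact: is_derive1_derivable (is_derive1B (is_derive1B (is_derive_expR s) dN)
      (is_derive1Z (2 * rho) (is_derive1_id s))).
  have f1 : f (ln rho) <= 0.
    by have := ler_sinh_mul_expR (ltW l0); rewrite /f lnK ?posrE//; lra.
  have f2 : 0 <= f (8 * rho).
    have h : 0 <= 8 * rho by lra.
    by have := ler_mul_sinh h; rewrite /f; nra.
  have [|k] := IVT lrho cf (v := 0).
    by rewrite ge_min le_max f1 f2 orbT.
  rewrite in_itv/= => /andP[lk _] fk.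
  have k0 : 0 < k by exact: lt_le_trans lk.
  exists (k ^+ 2); first by rewrite /= in_itv/= andbT; have := sqr_ge0 k; lra.
  rewrite g_sinh//; apply: (mulIf (x := k)); rewrite ?gt_eqF// divfK ?gt_eqF//.
  by move: fk; rewrite /f; lra.
- have rI : - 1 <= rho <= 1 by lra.
  have a0 : 0 < acos rho by apply: acos_gt0; lra.
  have ap : acos rho <= pi by exact: acos_lepi.
  have ca : cos (acos rho) = rho by apply: acosK; rewrite in_itv/=.
  pose f (s : R) := sin s - rho * s.
  have cf : {within `[acos rho, pi], continuous f}.
    apply: derivable_within_continuous => s _.
    exact: is_derive1_derivable (is_derive1B (is_derive_sin s)
      (is_derive1Z rho (is_derive1_id s))).
  have f1 : 0 <= f (acos rho).
    by have := ler_mul_cos_sin (ltW a0) ap; rewrite ca /f; lra.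
  have f2 : f pi < 0 by rewrite /f sinpi; have := mulr_gt0 rho0 p0; lra.
  have [|k] := IVT ap cf (v := 0).
    by rewrite ge_min le_max f1 (ltW f2) orbT.
  rewrite in_itv/= => /andP[lk kp] fk.
  have k0 : 0 < k by exact: lt_le_trans lk.
  have kp' : k < pi.
    by rewrite lt_neqAle kp andbT; apply/eqP => kE; move: f2; rewrite -kE fk ltxx.
  exists (- k ^+ 2).
    by rewrite /= in_itv/= andbT ltrN2 ltr_sqr ?nnegrE// ltW.
  rewrite g_sin//; apply: (mulIf (x := k)); rewrite ?gt_eqF// divfK ?gt_eqF//.
  by move: fk; rewrite /f; lra.
Qed.

Lemma ginvP rho : 0 < rho -> - pi ^+ 2 < @ginv R rho /\ @g R (ginv rho) = rho.
Proof.
move=> rho0; split; last first.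
  exact: (@surjpK _ _ (fun=> point) _ _ _ (@g_surj) rho (mem_set rho0)).
have /= := @surjpinv_image_sub _ _ (fun=> point) _ _ _ (@g_surj) _
  (ex_intro2 _ _ rho rho0 erefl).
by rewrite in_itv/= andbT.
Qed.

End GInverse.

(** * The value of the infimum *)

(* [cosg] is to [g] what cosh is to sinh. *)
Definition cosg (R : realType) (r : R) : R :=
  if 0 < r then (expR (Num.sqrt r) + expR (- Num.sqrt r)) / 2
  else if r == 0 then 1
  else cos (Num.sqrt (- r)).

(** In the trigonometric case r > - pi^2 means k T < pi, which keeps sin(k s) positive up to [T]. *)
Lemma sine_pair_exists (R : realType) (r T : R) : 0 < T -> - pi ^+ 2 < r ->
  exists S C : R -> R, [/\ sine_pair (r / T ^+ 2) S C,
    forall s, 0 < s -> s <= T -> 0 < S s, S T = T * g r & C T = cosg r].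
Proof.
move=> T0 rpi; have TN0 : T != 0 by rewrite gt_eqF.
have [r0|r0|->] := ltgtP r 0; last first.
- exists (fun s => s), (fun _ => 1); split => //.
  + split => // s; first exact: is_derive1_id.
    by rewrite !mul0r; exact: is_derive1_cst.
  + by rewrite g0 mulr1.
  + by rewrite /cosg ltxx eqxx.
- pose k := Num.sqrt r / T.
  have sr0 : 0 < Num.sqrt r by rewrite sqrtr_gt0.
  have k0 : 0 < k by rewrite divr_gt0.
  have kT : k * T = Num.sqrt r by rewrite divfK.
  have k2 : r / T ^+ 2 = k ^+ 2 by rewrite /k exprMn exprVn sqr_sqrtr// ltW.
  have d1 (s : R) := @is_derive1_chain R (@expR R) (fun s => k * s) s _ _
    (is_derive_expR _) (is_derive1Z k (is_derive1_id s)).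
  have d2 (s : R) := @is_derive1_chain R (@expR R) (fun s => (- k) * s) s _ _
    (is_derive_expR _) (is_derive1Z (- k) (is_derive1_id s)).
  exists (fun s => (2 * k)^-1 * (expR (k * s) - expR ((- k) * s))),
    (fun s => 2^-1 * (expR (k * s) + expR ((- k) * s))); split.
  + split.
    * move=> s; apply: is_derive_eq (is_derive1Z _ (is_derive1B (d1 s) (d2 s))) _.
      have kN0 : 2 * k != 0 by rewrite gt_eqF// mulr_gt0.
      by apply: (mulfI kN0); rewrite mulVKf//; lra.
    * move=> s; apply: is_derive_eq (is_derive1Z _ (is_derive1D (d1 s) (d2 s))) _.
      rewrite k2 invfM; set i := k^-1.
      have ki : k * i * k = k by rewrite (divff (lt0r_neq0 k0)) mul1r.
      have := congr1 ( *%R^~ (expR (k * s) - expR ((- k) * s))) ki => /=; lra.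
    * by rewrite !mulr0 subrr mulr0.
    * by rewrite !mulr0 expR0; lra.
  + move=> s s0 _; apply: mulr_gt0; first by rewrite invr_gt0 mulr_gt0.
    by rewrite subr_gt0 ltr_expR; have := mulr_gt0 k0 s0; lra.
  + rewrite mulNr kT -{3}(sqr_sqrtr (ltW r0)) g_sinh// -kT.
    rewrite !invfM -[LHS]mulr1 -[X in _ * X = _](divff TN0); lra.
  + by rewrite mulNr kT /cosg r0; lra.
- pose k := Num.sqrt (- r) / T.
  have Nr0 : 0 < - r by lra.
  have sr0 : 0 < Num.sqrt (- r) by rewrite sqrtr_gt0.
  have k0 : 0 < k by rewrite divr_gt0.
  have kT : k * T = Num.sqrt (- r) by rewrite divfK.
  have k2 : r / T ^+ 2 = - k ^+ 2.
    by rewrite /k exprMn exprVn sqr_sqrtr ?ltW// mulNr opprK.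
  have kpi : k * T < pi.
    by rewrite kT -(ger0_norm (pi_ge0 R)) -sqrtr_sqr ltr_sqrt ?exprn_gt0 ?pi_gt0//; lra.
  have d1 (s : R) := @is_derive1_chain R (@sin R) (fun s => k * s) s _ _
    (is_derive_sin _) (is_derive1Z k (is_derive1_id s)).
  have d2 (s : R) := @is_derive1_chain R (@cos R) (fun s => k * s) s _ _
    (is_derive_cos _) (is_derive1Z k (is_derive1_id s)).
  exists (fun s => k^-1 * sin (k * s)), (fun s => cos (k * s)); split.
  + split.
    * move=> s; apply: is_derive_eq (is_derive1Z _ (d1 s)) _.
      by rewrite mulr1 mulrCA (mulVf (lt0r_neq0 k0)) mulr1.
    * move=> s; apply: is_derive_eq (d2 s) _.
      have ki : k / k * k = k by rewrite (divff (lt0r_neq0 k0)) mul1r.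
      by have := congr1 ( *%R^~ (sin (k * s))) ki => /=; rewrite k2; lra.
    * by rewrite mulr0 sin0 mulr0.
    * by rewrite mulr0 cos0.
  + move=> s s0 sT; apply: mulr_gt0; first by rewrite invr_gt0.
    apply: sin_gt0_pi; rewrite mulr_gt0//=; apply: le_lt_trans kpi.
    by rewrite ler_pM2l.
  + have -> : g r = sin (k * T) / (k * T).
      by rewrite kT -{1}[r]opprK -{1}(sqr_sqrtr (ltW Nr0)) g_sin.
    by rewrite (invfM k T) -[LHS]mulr1 -[X in _ * X = _](divff TN0); lra.
  + by rewrite kT /cosg ltNge (ltW r0)/= lt_eqF.
Qed.

(** The extremal is admissible and its cost gives one inequality; the other is the convexity bound
    in u if [r <= 0], and in z, with [k = Num.sqrt r / T], if [r > 0]. *)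
Lemma Psi_cosg (R : realType) (x y t x0 y0 t0 r : R) :
  0 < x -> 0 < x0 -> t0 < t -> y < y0 -> - pi ^+ 2 < r ->
  g r = normalized_gap x y t x0 y0 t0 ->
  Psi x y t x0 y0 t0 = (4 * r / (t - t0) + (4 * (x + x0) / (y0 - y) -
    8 * Num.sqrt (x * x0) * cosg r / (y0 - y)))%:E.
Proof.
move=> xpos x0pos tt yy rpi gr.
have T0 : 0 < t - t0 by lra.
have h0 : 0 < y0 - y by lra.
rewrite /normalized_gap in gr; rewrite /Psi /admissible.
have qy0 : y0 = y + (y0 - y) by lra.
move: (t - t0) (y0 - y) T0 h0 gr qy0 => T h T0 h0 gr qy0.
have [ra ra0 raE] : exists2 ra, 0 < ra & Num.sqrt x = ra.
  by exists (Num.sqrt x) => //; rewrite sqrtr_gt0.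
have [rb rb0 rbE] : exists2 rb, 0 < rb & Num.sqrt x0 = rb.
  by exists (Num.sqrt x0) => //; rewrite sqrtr_gt0.
have xE : x = ra ^+ 2 by rewrite -raE sqr_sqrtr// ltW.
have x0E : x0 = rb ^+ 2 by rewrite -rbE sqr_sqrtr// ltW.
have rabE : Num.sqrt (x * x0) = ra * rb by rewrite sqrtrM ?raE ?rbE// ltW.
rewrite rabE in gr *.
have TN0 : T != 0 by rewrite gt_eqF.
have [S [C [SC Spos STE CTE]]] := sine_pair_exists T0 rpi.
have hE : h = S T * (ra * rb).
  rewrite STE gr invfM.
  have -> : T * (h * (T^-1 / (ra * rb))) * (ra * rb) =
    (T / T) * (h * ((ra * rb) / (ra * rb))) by lra.
  by rewrite !divff ?mul1r ?mulr1// gt_eqF// mulr_gt0.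
have costE : 4 * r / T + (4 * (x + x0) / h - 8 * (ra * rb) * cosg r / h) =
    4 * (r / T ^+ 2) * T + opt_mult (r / T ^+ 2) T ra rb S C * h.
  rewrite (opt_multh SC T0 ra0 rb0 Spos hE) CTE -xE -x0E; congr (_ + _).
  by rewrite -!mulrA; congr (_ * (_ * _)); rewrite expr2 invfM mulfVK.
apply/eqP; rewrite eq_le costE; apply/andP; split.
  rewrite -(opt_cost SC T0 ra0 rb0 Spos hE).
  have [q10 q1T q20 q2T] := opt_end SC T0 ra0 rb0 Spos hE.
  apply: ereal_inf_lbound; eexists; last reflexivity; split.
    exact: (opt_integrable SC T0 ra0 rb0 Spos).
  exists (opt_q1 T ra rb S C), (fun s => y + opt_q2 T ra rb S C s).
  split; first exact: (opt_solution SC T0 ra0 rb0 Spos).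
  - by rewrite q10 xE.
  - by rewrite q20 addr0.
  - by rewrite q1T x0E.
  - by rewrite q2T.
apply: le_ereal_inf_tmp => _ [w [intw [q1 [q2 [sol q10 q20 q1T q2T]]]] <-].
rewrite xE in q10; rewrite x0E in q1T; rewrite qy0 in q2T.
have [r0|r0] := leP r 0.
  apply: (opt_lower_bound_le0 SC T0 ra0 rb0 Spos hE _ intw sol) q20 _ _ => //.
  by rewrite pmulr_lle0// invr_gt0 exprn_gt0.
pose k := Num.sqrt r / T.
have sr0 : 0 < Num.sqrt r by rewrite sqrtr_gt0.
have k0 : 0 < k by rewrite divr_gt0.
have kT : k * T = Num.sqrt r by rewrite divfK.
have k2 : r / T ^+ 2 = k ^+ 2 by rewrite /k exprMn exprVn sqr_sqrtr// ltW.
have khE : 2 * k * h = ra * rb * (expR (k * T) - expR (- (k * T))).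
  have gE : g r = (expR (k * T) - expR (- (k * T))) / 2 / (k * T).
    by rewrite -{1}(sqr_sqrtr (ltW r0)) g_sinh// kT.
  rewrite hE STE gE; set d := _ - _.
  have -> : 2 * k * (T * (d / 2 / (k * T)) * (ra * rb)) =
    ra * rb * d * ((k * T) / (k * T)) by lra.
  by rewrite divff ?mulr1// gt_eqF// mulr_gt0.
have := lower_bound_gt0 k0 T0 ra0 rb0 h0 khE intw sol q10 q20 q1T q2T.
apply: le_trans; rewrite lee_fin (opt_multh SC T0 ra0 rb0 Spos hE).
by rewrite CTE /cosg r0 -kT k2; lra.
Qed.

Lemma cosg_pythagoras (R : realType) (r : R) : - pi ^+ 2 < r ->
  cosg r ^+ 2 = 1 + r * g r ^+ 2.
Proof.
move=> rpi; have [S [C [SC _ ST CT]]] := sine_pair_exists ltr01 rpi.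
have := sine_pair_pythagoras 1 SC.
by rewrite ST CT mul1r expr1n divr1; lra.
Qed.

(** At r = - pi^2/4 the argument sqrt(- r) of cos reaches pi/2. *)
Lemma cosg_ge0 (R : realType) (r : R) : - (pi ^+ 2 / 4) <= r -> 0 <= cosg r.
Proof.
move=> hr; rewrite /cosg; have [r0|r0] := ltP 0 r.
  by rewrite divr_ge0// addr_ge0// expR_ge0.
case: eqP => // _; apply: cos_ge0_pihalf.
have h : Num.sqrt (- r) <= pi / 2.
  rewrite -[leRHS]ger0_norm; last by rewrite divr_ge0// pi_ge0.
  by rewrite -sqrtr_sqr ler_wsqrtr//; lra.
by rewrite h andbT (le_trans _ (sqrtr_ge0 _))// oppr_le0 divr_ge0// pi_ge0.
Qed.

Lemma cosg_lt0 (R : realType) (r : R) : - pi ^+ 2 < r -> r < - (pi ^+ 2 / 4) ->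
  cosg r < 0.
Proof.
move=> rpi hr; have p0 := pi_gt0 R; have p2 : 0 < (pi : R) ^+ 2 by rewrite exprn_gt0.
have r0 : r < 0 by lra.
have -> : cosg r = cos (Num.sqrt (- r)) by rewrite /cosg ltNge (ltW r0)/= lt_eqF.
rewrite -cos_pihalf ltr_cos ?in_itv/=.
- rewrite -[ltLHS]ger0_norm; last by rewrite divr_ge0// ltW.
  by rewrite -sqrtr_sqr ltr_sqrt; lra.
- by rewrite divr_ge0 ?ltW//; lra.
- rewrite sqrtr_ge0/= -[leRHS]ger0_norm; last by rewrite ltW.
  by rewrite -sqrtr_sqr ler_wsqrtr//; lra.
Qed.

Lemma normalized_gap_gt0 (R : realType) (x y t x0 y0 t0 : R) :
  0 < x -> 0 < x0 -> t0 < t -> y < y0 -> 0 < normalized_gap x y t x0 y0 t0.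
Proof.
move=> *; rewrite divr_gt0 ?mulr_gt0 ?subr_gt0// sqrtr_gt0 mulr_gt0//.
Qed.

Lemma Psi_energy (R : realType) (x y t x0 y0 t0 : R) :
  0 < x -> 0 < x0 -> t0 < t -> y < y0 ->
  let E := energy x y t x0 y0 t0 in
  (- (pi ^+ 2 / (t - t0) ^+ 2) <= E ->
   Psi x y t x0 y0 t0 =
     (E * (t - t0) + 4 * (x + x0) / (y0 - y)
      - 4 * Num.sqrt (E + 4 * x * x0 / (y0 - y) ^+ 2))%:E) /\
  (E < - (pi ^+ 2 / (t - t0) ^+ 2) ->
   Psi x y t x0 y0 t0 =
     (E * (t - t0) + 4 * (x + x0) / (y0 - y)
      + 4 * Num.sqrt (E + 4 * x * x0 / (y0 - y) ^+ 2))%:E).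
Proof.
move=> xpos x0pos tt yy E.
have [rpi grE] := ginvP (normalized_gap_gt0 xpos x0pos tt yy).
rewrite (Psi_cosg xpos x0pos tt yy rpi grE).
have T0 : 0 < t - t0 by lra.
have h0 : 0 < y0 - y by lra.
have s0 : 0 < Num.sqrt (x * x0) by rewrite sqrtr_gt0 mulr_gt0.
have s2 : Num.sqrt (x * x0) ^+ 2 = x * x0 by rewrite sqr_sqrtr// ltW// mulr_gt0.
rewrite {}/E /energy; rewrite /normalized_gap in rpi grE *.
move: (ginv _) rpi grE => r rpi grE.
move: (t - t0) (y0 - y) (Num.sqrt (x * x0)) T0 h0 s0 s2 grE => T h s T0 h0 s0 s2 grE.
have TN0 : T != 0 by rewrite gt_eqF.
have hN0 : h != 0 by rewrite gt_eqF.
have T2N0 : T ^+ 2 != 0 by rewrite expf_neq0.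
have Ts : T * s != 0 by rewrite mulf_neq0// gt_eqF.
have ET : 4 / T ^+ 2 * r * T = 4 * r / T.
  by rewrite expr2 invfM; have := divff TN0; set i := T^-1 => Ti;
     have := congr1 (fun z => 4 * i * r * z) Ti => /=; lra.
have sqrtE : Num.sqrt (4 / T ^+ 2 * r + 4 * x * x0 / h ^+ 2) = 2 * s * `|cosg r| / h.
  have -> : 4 / T ^+ 2 * r + 4 * x * x0 / h ^+ 2 = (2 * s * cosg r / h) ^+ 2.
    have -> : 4 * x * x0 = 4 * s ^+ 2 by rewrite s2; lra.
    rewrite (exprMn _ (2 * s * cosg r)) (exprMn _ (2 * s)) (exprMn _ 2).
    rewrite cosg_pythagoras// grE (exprMn _ h) !exprVn (exprMn _ T) (invfM (T ^+ 2)).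
    set i := (h ^+ 2)^-1; set j := (T ^+ 2)^-1.
    set l := (s ^+ 2)^-1.
    have hi : h ^+ 2 * i = 1 by rewrite divff// expf_neq0.
    have sl : s ^+ 2 * l = 1 by rewrite divff// expf_neq0// gt_eqF.
    have -> : (2 ^+ 2 * s ^+ 2 * (1 + r * (h ^+ 2 * (j * l)))) * i =
       4 * s ^+ 2 * i + 4 * j * r * ((s ^+ 2 * l) * (h ^+ 2 * i)) by lra.
    by rewrite hi sl; lra.
  by rewrite sqrtr_sqr normrM normrM (gtr0_norm (x := 2 * s)) ?mulr_gt0//
     (gtr0_norm (x := h^-1))// invr_gt0.
(* Translates thresholds on the energy into thresholds on [r]: - pi^2/T^2 becomes - pi^2/4. *)
have rE (c : R) : (c / T ^+ 2 <= 4 / T ^+ 2 * r) = (c / 4 <= r).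
  by rewrite mulrAC ler_pM2r ?invr_gt0 ?exprn_gt0// ler_pdivrMr// mulrC.
rewrite sqrtE ET; split => hE; congr EFin.
  have c0 : 0 <= cosg r.
    by apply: cosg_ge0; rewrite -mulNr -rE mulNr.
  by rewrite ger0_norm//; lra.
have c0 : cosg r < 0.
  apply: cosg_lt0 => //; rewrite ltNge -mulNr -rE -ltNge mulNr//.
by rewrite ltr0_norm//; lra.
Qed.

(** * Asymptotics for large and small normalized gap *)

(** sin s / s is a value of cos, by the mean value theorem. So [g r > 1] forces [r > 0]. *)
Lemma g_le1 (R : realType) (r : R) : - pi ^+ 2 < r -> r <= 0 -> g r <= 1.
Proof.
move=> rpi; rewrite le_eqVlt => /predU1P[->|r0]; first by rewrite g0.
have Nr0 : 0 < - r by lra.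
have s0 : 0 < Num.sqrt (- r) by rewrite sqrtr_gt0.
rewrite -[r]opprK -(sqr_sqrtr (ltW Nr0)) g_sin//.
move: (Num.sqrt (- r)) s0 => s s0; rewrite ler_pdivrMr// mul1r.
have [|c _] := @MVT_segment R sin cos 0 s (ltW s0).
  by apply: continuous_subspaceT; exact: continuous_sin.
by rewrite sin0 !subr0 => ->; rewrite ler_piMl ?cos_le1// ltW.
Qed.

(** From rho <= e^k <= rho v^2 and ln v <= v, ln rho lies in [k - 2 v, k]. Hence k^2 - ln^2 rho is
    at most 4 v k, of order v^3, while ln^2 rho is of order v^4 and c <= k + 1. The bound v >= 9
    ensures v^2/4 <= k - 2 v. *)
Lemma sinh_asymptotic (R : realType) (k rho v : R) :
  0 < k -> 1 < rho -> expR k - expR (- k) = 2 * rho * k -> v ^+ 2 = 1 + 2 * k ->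
  9 <= v -> let c := (expR k + expR (- k)) / 2 / rho in
  v ^+ 2 / 4 <= ln rho /\ `|4 * k ^+ 2 - 4 * ln rho ^+ 2 - 8 * c| <= 20 * v ^+ 3.
Proof.
move=> k0 rho1 sE vE v9 c.
have rho0 : 0 < rho by lra.
have X0 := expR_gt0 k; have Y0 := expR_gt0 (- k).
have Y1 : expR (- k) <= 1 by rewrite -expR0 ler_expR; lra.
have XY : expR k * expR (- k) = 1 by rewrite -expRD subrr expR0.
have rhoX : rho <= expR k.
  by rewrite -(ler_pM2l k0); have := ler_sinh_mul_expR (ltW k0); rewrite sE; lra.
have lk : ln rho <= k by rewrite -[k]expRK ler_ln ?posrE.
have Xrho : expR k <= rho * v ^+ 2.
  have h : 1 + 2 * k <= expR (2 * k) by exact: expR_ge1Dx.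
  have X2 : expR (2 * k) = expR k ^+ 2 by rewrite expr2 -expRD; congr expR; lra.
  have : (1 + 2 * k) * expR (- k) <= expR k.
    have := ler_wpM2r (ltW Y0) h; rewrite X2 expr2 -mulrA XY mulr1.
    by [].
  have k20 : 0 < 2 * k by lra.
  move=> h2; rewrite vE -(ler_pM2l k20).
  have := congr1 ( *%R^~ (1 + 2 * k)) sE => /=; lra.
have kl : k - 2 * v <= ln rho.
  have v0 : 0 < v by lra.
  have : k <= ln rho + 2 * ln v.
    rewrite -[leLHS]expRK mulr_natl -lnXn// -lnM ?posrE ?exprn_gt0//.
    by rewrite ler_ln ?posrE// mulr_gt0// exprn_gt0.
  by have := ln_sublinear v0; lra.
have c0 : 0 <= c by rewrite /c !divr_ge0// ?ltW// addr_gt0.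
have c1 : c <= k + 1.
  rewrite /c ler_pdivrMr//.
  have -> : (expR k + expR (- k)) / 2 = rho * k + expR (- k) by lra.
  by lra.
have vk : k = (v ^+ 2 - 1) / 2 by lra.
have lv : v ^+ 2 / 4 <= ln rho by nra.
split => //; move: lk kl lv; set l := ln rho => lk kl lv.
have l0 : 0 <= l by nra.
have h1 : l ^+ 2 <= k ^+ 2 by rewrite ler_sqr ?nnegrE// ltW.
have h2 : k ^+ 2 - l ^+ 2 <= 4 * v * k.
  have -> : k ^+ 2 - l ^+ 2 = (k - l) * (k + l) by lra.
  apply: (@le_trans _ _ (2 * v * (2 * k))); last by lra.
  by apply: ler_pM; lra.
have h3 : 16 * (v * k) + 8 * (k + 1) <= 20 * v ^+ 3.
  have v81 : 81 <= v ^+ 2 by nra.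
  have v3 : v ^+ 3 = v * v ^+ 2 by lra.
  by rewrite v3 vk; nra.
by rewrite ler_norml; apply/andP; split; nra.
Qed.

(** The error 20 v^3 has to be below e v^4/4, so e v > 80 suffices; [g r > expR (m ^+ 2)] forces k >
    m^2, hence v >= m with e m >= 81. *)
Lemma g_asymptotic_pinfty (R : realType) (e : R) : 0 < e ->
  exists M : R, forall r : R, - pi ^+ 2 < r -> M < g r -> 1 < g r /\
    `|4 * r - 4 * ln (g r) ^+ 2 - 8 * cosg r / g r| < e * (4 * ln (g r) ^+ 2).
Proof.
move=> e0; have ei0 : 0 < 81 / e by rewrite divr_gt0.
pose m := 9 + 81 / e; exists (expR (m ^+ 2)) => r rpi gM.
have m9 : 9 < m by rewrite /m; lra.
have em : 81 <= e * m by rewrite /m mulrDr mulrCA divff ?gt_eqF//; lra.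
have g1 : 1 < g r.
  by apply: le_lt_trans gM; rewrite -expR0 ler_expR sqr_ge0.
split => //.
have r0 : 0 < r by rewrite ltNge; apply/negP => /(g_le1 rpi); lra.
have [k k0 rk] : exists2 k, 0 < k & r = k ^+ 2.
  by exists (Num.sqrt r); rewrite ?sqrtr_gt0// sqr_sqrtr// ltW.
have gE : expR k - expR (- k) = 2 * g r * k.
  by rewrite rk g_sinh// mulrA mulfVK ?gt_eqF//; lra.
have gk : g r <= expR k.
  rewrite -(ler_pM2l k0); have := ler_sinh_mul_expR (ltW k0); rewrite gE; lra.
have mk : m ^+ 2 < k by rewrite -ltr_expR; exact: lt_le_trans gk.
pose v := Num.sqrt (1 + 2 * k).
have vE : v ^+ 2 = 1 + 2 * k by rewrite sqr_sqrtr//; lra.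
have vm : m <= v.
  by rewrite -ler_sqr ?nnegrE ?sqrtr_ge0// ?vE; lra.
have [|lv] := sinh_asymptotic k0 g1 gE vE; first by lra.
have -> : (expR k + expR (- k)) / 2 = cosg r.
  by rewrite rk /cosg exprn_gt0// sqrtr_sqr gtr0_norm.
rewrite -rk mulrA => /le_lt_trans; apply.
have v0 : 0 < v by lra.
have l2 : (v ^+ 2 / 4) ^+ 2 <= ln (g r) ^+ 2.
  by rewrite ler_sqr ?nnegrE ?divr_ge0 ?sqr_ge0// (le_trans _ lv)// divr_ge0 ?sqr_ge0.
have ev : 81 <= e * v by apply: (le_trans em); rewrite ler_pM2l.
have v3 : 0 < v ^+ 3 by rewrite exprn_gt0.
have := ler_wpM2r (ltW v3) ev; have := ler_wpM2l (ltW e0) l2; lra.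
Qed.

(** The error is merely bounded, by 4 pi^2 + 8 pi, whereas 8 / g r tends to infinity; [N] adds the
    term 4 e pi^2 coming from the right side. The cutoff 1/2 on [g r] forces r < 0 and cos(sqrt(-
    r)) <= 0. *)
Lemma g_asymptotic_0 (R : realType) (e : R) : 0 < e ->
  exists2 d : R, 0 < d & forall r : R, - pi ^+ 2 < r -> 0 < g r -> g r < d ->
    0 < 8 / g r - 4 * pi ^+ 2 /\
    `|4 * r + 4 * pi ^+ 2 - 8 * (1 + cosg r) / g r| <
      e * (8 / g r - 4 * pi ^+ 2).
Proof.
move=> e0; have p0 := pi_gt0 R; have p2 : 0 < (pi : R) ^+ 2 by rewrite exprn_gt0.
have ep : 0 < e * pi ^+ 2 by rewrite mulr_gt0.
pose N := 4 * pi ^+ 2 + 8 * pi + 4 * (e * pi ^+ 2) : R.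
have N0 : 0 < N by rewrite /N; lra.
exists (Num.min (2^-1) (8 * e / N)).
  by rewrite lt_min invr_gt0 divr_gt0// ?mulr_gt0//= ltr0n.
move=> r rpi g0'; rewrite lt_min => /andP[g2 gN].
have e8 : N < e * (8 / g r).
  by move: gN; rewrite ltr_pdivlMr// mulrC -ltr_pdivlMr//; lra.
have D0 : 0 < 8 / g r - 4 * pi ^+ 2.
  by rewrite -(pmulr_rgt0 _ e0) mulrBr; move: e8; rewrite /N; lra.
split => //.
have r0 : r < 0.
  rewrite ltNge le_eqVlt; apply/negP => /predU1P[r0|r0].
    by move: g2; rewrite -r0 g0; lra.
  have k0 : 0 < Num.sqrt r by rewrite sqrtr_gt0.
  move: g2; rewrite -(sqr_sqrtr (ltW r0)) g_sinh// ltr_pdivrMr//.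
  by have := ler_mul_sinh (ltW k0); have := sqr_ge0 (Num.sqrt r); lra.
have Nr0 : 0 < - r by lra.
have [s s0 rs] : exists2 s, 0 < s & r = - s ^+ 2.
  by exists (Num.sqrt (- r)); rewrite ?sqrtr_gt0// sqr_sqrtr ?opprK// ltW.
have sp : s < pi by rewrite -ltr_sqr ?nnegrE ?ltW//; lra.
have sg : sin s = g r * s by rewrite rs g_sin// divfK// gt_eqF.
have cE : cosg r = cos s.
  rewrite /cosg ltNge (ltW r0)/= lt_eqF// rs opprK sqrtr_sqr gtr0_norm//.
have cs := cos2Dsin2 s; have s1 := sin_le1 s.
(* By the half-angle formulas (s/2) (1 + cos s) <= sin s = g(r) s < s/2, which excludes cos s >
   0. *)
have c0 : cos s <= 0.
  rewrite leNgt; apply/negP => c0.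
  have h1 := ler_mul_cos_sin (s := s / 2) _ _.
  have {}h1 : s / 2 * cos (s / 2) <= sin (s / 2) by apply: h1; lra.
  have ss : sin s = 2 * (sin (s / 2) * cos (s / 2)).
    by have := sinD (s / 2) (s / 2); rewrite -splitr => ->; lra.
  have cc : cos s = 2 * cos (s / 2) ^+ 2 - 1.
    have := cosD (s / 2) (s / 2); rewrite -splitr => ->.
    by have := cos2Dsin2 (s / 2); lra.
  have ch : 0 <= cos (s / 2) by apply: cos_ge0_pihalf; lra.
  have := ler_wpM2r ch h1 => h2.
  have : s / 2 * (1 + cos s) <= sin s by rewrite ss cc; lra.
  have := mulr_gt0 s0 c0.
  have : g r * s < 2^-1 * s by rewrite ltr_pM2r.
  rewrite sg; lra.
have sin0' : 0 <= sin s by rewrite sg mulr_ge0// ltW.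
have c1 : 0 <= 1 + cos s by have := cos_geN1 s; lra.
have cb : 1 + cos s <= g r * pi.
  apply: (@le_trans _ _ (sin s)); last by rewrite sg ler_pM2l// ltW.
  have : 0 <= (1 + cos s) * (- cos s) by rewrite mulr_ge0// oppr_ge0.
  have : 0 <= sin s * (1 - sin s) by rewrite mulr_ge0// subr_ge0.
  lra.
have q0 : 0 <= 8 * (1 + cosg r) / g r.
  by rewrite cE; apply: divr_ge0; [rewrite mulr_ge0|exact: ltW].
have q1 : 8 * (1 + cosg r) / g r <= 8 * pi.
  by rewrite cE ler_pdivrMr//; lra.
have s2 : s ^+ 2 < pi ^+ 2 by lra.
have s20 := sqr_ge0 s.
move: e8; rewrite /N => e8.
by rewrite ltr_norml mulrBr; apply/andP; split; lra.
Qed.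

Lemma ereal_ratio_near1 (R : realType) (P D e : R) :
  0 < D -> `|P - D| < e * D -> (`| P%:E / D%:E - 1 | < e%:E)%E.
Proof.
move=> D0 PD; rewrite inver gt_eqF// -EFinM -EFinB abse_EFin lte_fin.
rewrite -(ltr_pM2r D0) -{2}(gtr0_norm D0) -normrM mulrBl divfK ?gt_eqF//.
by rewrite mul1r.
Qed.

(** As h = g(r) T sqrt(x x0), the data enter only through a function of [r] divided by T and the
    term 4 (x + x0)/h, which also occurs in both comparison functions and cancels from the
    differences. *)
Lemma Psi_gap (R : realType) (x y t x0 y0 t0 r : R) :
  0 < x -> 0 < x0 -> t0 < t -> y < y0 -> - pi ^+ 2 < r ->
  g r = normalized_gap x y t x0 y0 t0 ->
  Psi x y t x0 y0 t0 = ((4 * r - 8 * cosg r / g r) / (t - t0) +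
    4 * (x + x0) / (y0 - y))%:E.
Proof.
move=> xpos x0pos tt yy rpi gr; rewrite (Psi_cosg xpos x0pos tt yy rpi gr).
have TN0 : t - t0 != 0 by rewrite gt_eqF// subr_gt0.
congr EFin; rewrite gr /normalized_gap invf_div.
move: (t - t0) (y0 - y) TN0 => T h TN0.
have -> : 8 * cosg r * (T * Num.sqrt (x * x0) / h) =
    8 * Num.sqrt (x * x0) * cosg r / h * T by lra.
by rewrite mulrBl mulfK//; lra.
Qed.

(** The limits are uniform over all data with a given normalized gap [rho], since only this ratio is
    prescribed to converge. *)
Theorem proposition1p4 (R : realType) :
  [/\ (forall x y t x0 y0 t0 : R,
         0 < x -> 0 < x0 -> t0 < t -> y < y0 ->
         let E := energy x y t x0 y0 t0 in
         (- (pi ^+ 2 / (t - t0) ^+ 2) <= E ->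
            Psi x y t x0 y0 t0 =
              (E * (t - t0) + 4 * (x + x0) / (y0 - y)
               - 4 * Num.sqrt (E + 4 * x * x0 / (y0 - y) ^+ 2))%:E) /\
         (- (4 * pi ^+ 2 / (t - t0) ^+ 2) < E ->
            E < - (pi ^+ 2 / (t - t0) ^+ 2) ->
            Psi x y t x0 y0 t0 =
              (E * (t - t0) + 4 * (x + x0) / (y0 - y)
               + 4 * Num.sqrt (E + 4 * x * x0 / (y0 - y) ^+ 2))%:E)),
      (forall e : R, 0 < e ->
         \forall rho \near +oo,
         forall x y t x0 y0 t0 : R,
         0 < x -> 0 < x0 -> t0 < t -> y < y0 ->
         normalized_gap x y t x0 y0 t0 = rho ->
         (`| Psi x y t x0 y0 t0
             / (4 / (t - t0) * ln (normalized_gap x y t x0 y0 t0) ^+ 2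
                + 4 * (x0 + x) / (y0 - y))%R%:E - 1 | < e%:E)%E) &
      (forall e : R, 0 < e ->
         \forall rho \near 0^'+,
         forall x y t x0 y0 t0 : R,
         0 < x -> 0 < x0 -> t0 < t -> y < y0 ->
         normalized_gap x y t x0 y0 t0 = rho ->
         (`| Psi x y t x0 y0 t0
             / (4 * (Num.sqrt x + Num.sqrt x0) ^+ 2 / (y0 - y)
                - 4 * pi ^+ 2 / (t - t0))%R%:E - 1 | < e%:E)%E)].
Proof.
split.
- move=> x y t x0 y0 t0 xpos x0pos tt yy E.
  by have [hge hlt] := Psi_energy xpos x0pos tt yy; split => // _; exact: hlt.
- move=> e e0; have [M MP] := g_asymptotic_pinfty e0.
  exists M; split; first exact: num_real.
  move=> rho Mrho x y t x0 y0 t0 xpos x0pos tt yy gapE.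
  have rho0 := normalized_gap_gt0 xpos x0pos tt yy; rewrite gapE in rho0.
  have [rpi gr] := ginvP rho0.
  have := MP _ rpi; rewrite gr => /(_ Mrho)[rho1 asym].
  have -> := Psi_gap xpos x0pos tt yy rpi _; last by rewrite gr gapE.
  have T0 : 0 < t - t0 by rewrite subr_gt0.
  have h0 : 0 < 4 * (x0 + x) / (y0 - y).
    by rewrite divr_gt0 ?subr_gt0// mulr_gt0// addr_gt0.
  have l0 : 0 < ln rho by rewrite ln_gt0.
  rewrite gr gapE (addrC x x0); apply: ereal_ratio_near1.
    by apply: addr_gt0 => //; rewrite mulr_gt0 ?divr_gt0// exprn_gt0.
  rewrite [X in `|X|](_ : _ = (4 * ginv rho - 4 * ln rho ^+ 2 -
    8 * cosg (ginv rho) / rho) / (t - t0)) ?normrM; last by lra.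
  rewrite (gtr0_norm (x := (t - t0)^-1)) ?invr_gt0//.
  (* The common term is positive and only enlarges the denominator. *)
  apply: (@lt_le_trans _ _ (e * (4 * ln rho ^+ 2) / (t - t0))).
    by rewrite ltr_pM2r ?invr_gt0.
  by have := mulr_ge0 (ltW e0) (ltW h0); lra.
- move=> e e0; have [d d0 dP] := g_asymptotic_0 e0.
  have := nbhs_right_lt d0; apply: filterS.
  move=> rho rhod x y t x0 y0 t0 xpos x0pos tt yy gapE.
  have rho0 := normalized_gap_gt0 xpos x0pos tt yy; rewrite gapE in rho0.
  have [rpi gr] := ginvP rho0.
  have := dP _ rpi; rewrite gr => /(_ rho0 rhod)[D0 asym].
  have -> := Psi_gap xpos x0pos tt yy rpi _; last by rewrite gr gapE.
  have T0 : 0 < t - t0 by rewrite subr_gt0.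
  have h0 : 0 < 4 * (x + x0) / (y0 - y).
    by rewrite divr_gt0 ?subr_gt0// mulr_gt0// addr_gt0.
  (* The cross term 8 sqrt(x x0)/(y0 - y) of the square is 8 / rho divided by [t - t0]. *)
  have -> : 4 * (Num.sqrt x + Num.sqrt x0) ^+ 2 / (y0 - y) - 4 * pi ^+ 2 / (t - t0) =
      (8 / rho - 4 * pi ^+ 2) / (t - t0) + 4 * (x + x0) / (y0 - y).
    have TN0 : t - t0 != 0 by rewrite gt_eqF.
    rewrite -gapE /normalized_gap invf_div sqrtrM ?ltW// sqrrD !sqr_sqrtr ?ltW//.
    move: (t - t0) (y0 - y) TN0 => T h TN0.
    have -> : 8 * (T * (Num.sqrt x * Num.sqrt x0) / h) =
      8 * (Num.sqrt x * Num.sqrt x0) / h * T by lra.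
    by rewrite mulrBl mulfK//; lra.
  rewrite gr; apply: ereal_ratio_near1.
    by apply: addr_gt0 => //; rewrite divr_gt0.
  rewrite opprD addrACA subrr addr0 -mulrBl normrM.
  rewrite (gtr0_norm (x := (t - t0)^-1)) ?invr_gt0//.
  apply: (@lt_le_trans _ _ (e * (8 / rho - 4 * pi ^+ 2) / (t - t0))).
    rewrite ltr_pM2r ?invr_gt0//; apply: le_lt_trans asym.
    by rewrite le_eqVlt; apply/orP; left; apply/eqP; congr (`|_|); lra.
  by have := mulr_ge0 (ltW e0) (ltW h0); lra.
Qed.
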